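(* Let $\beta>1$ be a real number, with $\beta$-shift $S_\beta$ and $\beta$-kernel $K_\beta$. Then: (1) $(S_\beta:K_\beta)$ is SFT/SFT if and only if $\beta\in\mathbb N$; (2) $(S_\beta:K_\beta)$ is SFT/(proper sofic) if and only if $\beta\notin\mathbb N$ and $d^*_\beta(1)$ is totally periodic; (3) $(S_\beta:K_\beta)$ is (proper sofic)/(proper sofic) if and only if $d^*_\beta(1)$ is strictly eventually periodic; (4) $(S_\beta:K_\beta)$ is (non-sofic)/SFT if and only if $\{\sigma^i(d^*_\beta(1)) : i\in\mathbb N\}$ is dense in $S_\beta$; (5) $(S_\beta:K_\beta)$ is (non-sofic)/(non-sofic) in all other cases. In particular, $(S_\beta:K_\beta)$ is never SFT/(non-sofic), (non-sofic)/(proper sofic) or (proper sofic)/SFT.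
   Context: $T_\beta:[0,1]\to[0,1]$ is $T_\beta(x)=\beta x-\lfloor\beta x\rfloor$. The $\beta$-expansion of $x\in[0,1]$ is $d_\beta(x)=(x_i)_{i\in\mathbb N}$ with $x_i=\lfloor\beta T_\beta^i(x)\rfloor\in A=\{0,1,\dots,\lfloor\beta\rfloor\}$. $D_\beta$ is the set of $\beta$-expansions of numbers in $[0,1)$, and the $\beta$-shift $S_\beta$ is the closure of $D_\beta$ in $A^{\mathbb N}$, with the shift $\sigma$. If $d_\beta(1)=t_0t_1\dots t_m0^\infty$ with $t_m\ne0$, let $d^*_\beta(1)=(t_0t_1\dots t_{m-1}(t_m-1))^\infty$; otherwise let $d^*_\beta(1)=d_\beta(1)$. Let $\mathrm{real}:S_\beta\to[0,1]$, $\mathrm{real}((x_i)_i)=\sum_{i\ge0}x_i\beta^{-(i+1)}$. The $\beta$-kernel $K_\beta\subset S_\beta\times S_\beta$ is the minimal closed $\sigma$-invariant equivalence relation on $S_\beta$ containing $\{(x_1,x_2)\in S_\beta^2:\mathrm{real}(x_1)=\mathrm{real}(x_2)\}$. A sequence is totally periodic if it has the form $w^\infty$ ($w$ a nonempty word), eventually periodic if it has the form $uw^\infty$, and strictly eventually periodic if it is eventually but not totally periodic. A subshift over $\mathbb N$ is an SFT if defined by finitely many forbidden words, sofic if it is the image of an SFT under a continuous shift-commuting map, and proper sofic if sofic but not SFT. ''$(S_\beta:K_\beta)$ is $P/Q$'' means that $S_\beta$ has property $P$ and $K_\beta$ has property $Q$, where for the denominator the properties are taken relative to $S_\beta^2$: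 $K_\beta$ is (relatively) SFT, respectively sofic, if $K_\beta=Z\cap S_\beta^2$ for some SFT, respectively sofic shift, $Z\subset(A^2)^{\mathbb N}$; it is proper sofic if it is relatively sofic but not relatively SFT; and non-sofic if it is not relatively sofic. *)

(* Defs.v *)
From HB Require Import structures.
From mathcomp Require Import all_boot all_order all_algebra.
From mathcomp Require Import all_classical all_reals all_analysis.

Set Implicit Arguments.
Unset Strict Implicit.
Unset Printing Implicit Defensive.

Import Order.TTheory GRing.Theory Num.Theory.
Import numFieldNormedType.Exports.

Local Open Scope classical_set_scope.
Local Open Scope ring_scope.

(** * One-sided symbolic dynamics *)

(* The default topology on a bare arrow type depends on the imported modules
   (uniform or pointwise convergence), hence the explicit [prod_topology]. *)
Notation configuration A :=
  (prod_topology (fun _ : nat => discrete_topology A)).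

Definition shift (A : finType) (x : configuration A) : configuration A :=
  fun i => x i.+1.

Definition occurs (A : finType) (w : seq A) (x : configuration A) : Prop :=
  exists i : nat, mkseq (fun j => x (i + j)%N) (size w) = w.

Definition is_SFT (A : finType) (X : set (configuration A)) : Prop :=
  exists F : seq (seq A), X = [set x | forall w, w \in F -> ~ occurs w x].

Definition is_sofic (A : finType) (Y : set (configuration A)) : Prop :=
  exists (B : finType) (X : set (configuration B))
         (phi : configuration B -> configuration A),
    [/\ is_SFT X,
        {within X, continuous phi},
        forall x, X x -> phi (shift x) = shift (phi x)
      & phi @` X = Y].

Definition is_proper_sofic (A : finType) (X : set (configuration A)) : Prop :=
  is_sofic X /\ ~ is_SFT X.

Definition is_non_sofic (A : finType) (X : set (configuration A)) : Prop :=
  ~ is_sofic X.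

Definition zip_conf (A : finType) (p : configuration A * configuration A) :
    configuration (A * A)%type :=
  fun i => (p.1 i, p.2 i).

(* Properties of a relation [K] on [S], relative to [S `*` S]; a pair of
   sequences is identified with a sequence of pairs through [zip_conf]. *)
Definition rel_SFT (A : finType) (S : set (configuration A))
    (K : set (configuration A * configuration A)) : Prop :=
  exists Z : set (configuration (A * A)%type),
    is_SFT Z /\ K = (@zip_conf A @^-1` Z) `&` (S `*` S).

Definition rel_sofic (A : finType) (S : set (configuration A))
    (K : set (configuration A * configuration A)) : Prop :=
  exists Z : set (configuration (A * A)%type),
    is_sofic Z /\ K = (@zip_conf A @^-1` Z) `&` (S `*` S).

Definition rel_proper_sofic (A : finType) (S : set (configuration A))
    (K : set (configuration A * configuration A)) : Prop :=
  rel_sofic S K /\ ~ rel_SFT S K.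

Definition rel_non_sofic (A : finType) (S : set (configuration A))
    (K : set (configuration A * configuration A)) : Prop :=
  ~ rel_sofic S K.

(* [prepend u x] is the sequence u x, [omega a w] is w^oo for nonempty [w];
   [a] is only a default value for [nth]. *)
Definition prepend (A : finType) (u : seq A) (x : configuration A) :
    configuration A :=
  fun i => if (i < size u)%N then nth (x 0%N) u i else x (i - size u)%N.

Definition omega (A : finType) (a : A) (w : seq A) : configuration A :=
  fun i => nth a w (i %% size w).

Definition totally_periodic (A : finType) (x : configuration A) : Prop :=
  exists (a : A) (w : seq A), w != [::] /\ x = omega a w.

Definition eventually_periodic (A : finType) (x : configuration A) : Prop :=
  exists (a : A) (u w : seq A), w != [::] /\ x = prepend u (omega a w).

Definition strictly_eventually_periodic (A : finType) (x : configuration A) :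
    Prop :=
  eventually_periodic x /\ ~ totally_periodic x.

Definition orbit_of (A : finType) (x : configuration A) :
    set (configuration A) :=
  range (fun i : nat => iter i (@shift A) x).

Definition dense_in (T : topologicalType) (D S : set T) : Prop :=
  D `<=` S /\ S `<=` closure D.

Definition equivalence_on (T : Type) (S : set T) (E : set (T * T)) : Prop :=
  [/\ E `<=` S `*` S,
      forall x, S x -> E (x, x),
      forall x y, E (x, y) -> E (y, x)
    & forall x y z, E (x, y) -> E (y, z) -> E (x, z)].

Definition closed_invariant_equivalence (A : finType)
    (S : set (configuration A)) (E : set (configuration A * configuration A)) :
    Prop :=
  [/\ equivalence_on S E,
      closed E
    & forall x y, E (x, y) -> E (shift x, shift y)].

(** * Beta-shifts *)

Section BetaShift.
Context {R : realType} (beta : R).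

Definition beta_map (x : R) : R := beta * x - (Num.floor (beta * x))%:~R.

(* For [0 <= beta], [Num.truncn beta] is the floor of [beta], as a natural
   number. *)
Notation digit := 'I_(Num.truncn beta).+1.

(* For x in [0, 1] the argument of [inord] is at most floor(beta), see
   [beta_expansionE] below. *)
Definition beta_expansion (x : R) : configuration digit :=
  fun i => inord (Num.truncn (beta * iter i beta_map x)).

Definition beta_shift : set (configuration digit) :=
  closure [set beta_expansion x | x in `[0, 1[].

Definition last_nonzero (t : configuration digit) (m : nat) : Prop :=
  t m != ord0 /\ forall i, (m < i)%N -> t i = ord0.

Definition quasi_expansion_one : configuration digit :=
  let t := beta_expansion 1 in
  if `[< exists m, last_nonzero t m >] then
    let m := [get m : nat | last_nonzero t m] in
    omega ord0 (rcons (mkseq t m) (inord (t m).-1))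
  else t.

Definition real_of (x : configuration digit) : R :=
  limn (series (fun i : nat => ((x i : digit) : nat)%:R * beta ^- i.+1)).

Definition beta_kernel : set (configuration digit * configuration digit) :=
  smallest (closed_invariant_equivalence beta_shift)
    [set p | [/\ beta_shift p.1, beta_shift p.2 & real_of p.1 = real_of p.2]].

Lemma iter_beta_map_itv (x : R) (i : nat) :
  0 <= x <= 1 -> 0 <= iter i beta_map x <= 1.
Proof.
move=> x01; case: i => [//|i]; rewrite iterS {1 2}/beta_map.
set y := beta * _; have /andP[h1 h2] := floor_itv y.
by rewrite subr_ge0 h1 lerBlDl -[X in _ + X]/(1%:~R) -intrD ltW.
Qed.

Lemma beta_expansionE (x : R) (i : nat) : 1 < beta -> 0 <= x <= 1 ->
  beta_expansion x i = Num.truncn (beta * iter i beta_map x) :> nat.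
Proof.
move=> b1 /(@iter_beta_map_itv x i)/andP[y0 y1].
rewrite /beta_expansion inordK// ltnS le_truncn//.
by rewrite ler_piMr// (le_trans ler01 (ltW b1)).
Qed.

End BetaShift.

Arguments beta_shift {R} beta _.
Arguments quasi_expansion_one {R} beta _.
Arguments last_nonzero {R} beta _ _.
Arguments real_of {R} beta _.
Arguments beta_kernel {R} beta _.

(* Main.v *)
Require Import Defs.
From HB Require Import structures.
From mathcomp Require Import all_boot all_order all_algebra.
From mathcomp Require Import all_classical all_reals all_analysis.
From mathcomp Require Import zify ring lra.

(** Write S for the beta-shift, d for the quasi-greedy expansion of 1, K for
    the beta-kernel.

    The shift.  The remainders of d lie in (0, 1], so d is the largest sequence
    of S, its value is 1, and it does not end in zeros.  Comparing remainders
    gives Parry's description: S consists of the sequences all of whose shifts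
    are lexicographically at most d ([beta_shiftE]).  The followers in S of the
    prefix of length n of d are the points of S below sigma^n d, so that S is
    sofic if and only if d is eventually periodic, and of finite type if and
    only if d is totally periodic ([beta_shift_soficP], [beta_shift_SFTP]).

    The kernel.  Two distinct points of S have the same value only if they are
    u a d and u (a+1) 0^oo ([real_of_coincidence]).  Shifting such a pair yields
    (d, 0^oo), so K identifies 0^oo with the whole orbit closure C of d.  Hence
    K consists of the pairs with equal values, together with the pairs of
    points whose values are values of points of C or of 0^oo
    ([beta_kernelE]): there is a single exceptional class.

    The classification rests on the following facts.
    - If the orbit of d is dense, the exceptional class is S, and K is the full
      relation ([dense_rel_SFT]).
    - If d is not eventually periodic and K is sofic, two prefixes of the pair
      (u 0 d, u 1 0^oo) have the same followers in K; exchanging the tails shows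
      that u 1 0^oo lies in the exceptional class.  Here u may be any word of S
      followed by enough zeros, so the orbit of d is dense
      ([rel_sofic_dense]).
    - If d is eventually periodic, the exceptional class is finite and K is
      presented by a finite graph ([eventually_periodic_rel_sofic]).
    - If moreover beta is not an integer, the exceptional class contains two
      points a z and b z with a <> b.  Replacing z by points of S which agree
      with z for a long time gives pairs outside K whose windows of a given
      length all occur in K, so K is not of finite type ([not_rel_SFT]).
    - If beta is an integer, d is constant and K is described by its windows of
      length 3 ([nat_rel_SFT]). *)

Set Implicit Arguments.
Unset Strict Implicit.
Unset Printing Implicit Defensive.

Import Order.TTheory GRing.Theory Num.Theory.
Import numFieldNormedType.Exports.

Local Open Scope classical_set_scope.

(* The bare name [shift] also denotes the translations of a vector space. *)
Notation sigma := Defs.shift.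

(** * Configurations, cylinders and compactness *)

Section Configurations.
Context {A : finType}.
Implicit Types (x y z : configuration A) (X Y : set (configuration A)).

(** [agree n x y]: the sequences [x] and [y] have the same first [n] letters,
    that is, [y] lies in the cylinder of length [n] around [x]. *)
Definition agree n x y := forall i, (i < n)%N -> x i = y i.

Lemma agree_sym n x y : agree n x y -> agree n y x.
Proof. by move=> h i /h. Qed.

Lemma agree_trans n x y z : agree n x y -> agree n y z -> agree n x z.
Proof. by move=> h1 h2 i ni; rewrite h1 // h2. Qed.

Lemma agree_le m n x y : (m <= n)%N -> agree n x y -> agree m x y.
Proof. by move=> mn h i im; apply: h; apply: leq_trans mn. Qed.

Lemma agree_eq x y : (forall n, agree n x y) -> x = y.
Proof. by move=> h; apply/funext => i; apply: (h i.+1). Qed.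

Lemma first_difference x y : x <> y -> exists n, agree n x y /\ x n <> y n.
Proof.
move=> xy; have : exists n, `[< x n <> y n >].
  apply/not_existsP => h; apply: xy; apply/funext => n.
  by apply: contrapT => k; apply: (h n); apply/asboolP.
move=> ex; case: (ex_minnP ex) => n /asboolP xyn mn; exists n; split=> // i ni.
by apply: contrapT => /asboolP/mn; rewrite leqNgt ni.
Qed.

Lemma nbhs_agree x n : nbhs x [set y | agree n x y].
Proof.
elim: n => [|n IHn].
  by apply: (@filterS _ _ _ setT) => [y _ i //|]; exact: filterT.
have xn : nbhs (x : configuration A) [set y | y n = x n].
  have := @proj_continuous nat (fun=> discrete_topology A) n x.
  by move=> /(_ [set x n]); apply; exact: discrete_set1.
apply: filterS (filterI IHn xn) => y [h /= hn] i.
by rewrite ltnS leq_eqVlt => /orP[/eqP->|/h].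
Qed.

Lemma nbhs_cylinder x (U : set (configuration A)) :
  nbhs x U <-> exists n, forall y, agree n x y -> U y.
Proof.
split; last by move=> [n h]; apply: filterS (nbhs_agree x n).
pose F : set_system (configuration A) :=
  [set V | exists n, forall y, agree n x y -> V y].
have FF : Filter F.
  split; first by exists 0%N.
    move=> P Q [n hn] [m hm]; exists (maxn n m) => y h; split.
      by apply: hn; apply: agree_le h; rewrite leq_maxl.
    by apply: hm; apply: agree_le h; rewrite leq_maxr.
  by move=> P Q PQ [n h]; exists n => y /h /PQ.
suff /(_ U) : F --> x by [].
apply/cvg_sup => N V [W] [ [G] oG <-] Gx GV.
by apply: (filterS GV); exists N.+1 => y /(_ N) /= <-.
Qed.

Lemma closure_cylinder X x :
  closure X x <-> forall n, exists2 y, X y & agree n x y.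
Proof.
split=> [cl n|h U /nbhs_cylinder[n nU]].
  by have [y [Xy xy]] := cl _ (nbhs_agree x n); exists y.
by have [y Xy xy] := h n; exists y; split=> //; exact: nU.
Qed.

Lemma compact_configurations : compact [set: configuration A].
Proof.
have := @tychonoff nat (fun=> discrete_topology A) (fun=> setT).
have -> : [set f : configuration A | forall i, setT (f i)] = setT.
  by apply/seteqP; split.
apply=> i; apply: finite_compact.
exact: (@finite_finset A setT).
Qed.

(** Every sequence of configurations has a cluster point. *)
Lemma sequence_cluster (u : nat -> configuration A) :
  exists x, forall n N, exists2 m, (N <= m)%N & agree n x (u m).
Proof.
have [x [_ cx]] := @compact_configurations (u @ \oo) _ filterT.
exists x => n N.
have [|_ [ [m Nm <-] xm]] :=
  cx (u @` [set m | (N <= m)%N]) _ _ (nbhs_agree x n).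
  by exists N => // m /= Nm; exists m.
by exists m.
Qed.

Lemma iter_shiftE n x i : iter n (@sigma A) x i = x (n + i)%N.
Proof. by elim: n i => // n IHn i; rewrite iterS /sigma IHn addnS. Qed.

Lemma iter_shift n x : iter n (@sigma A) x = fun i => x (n + i)%N.
Proof. by apply/funext => i; rewrite iter_shiftE. Qed.

Lemma agree_shift n x y : agree n.+1 x y -> agree n (sigma x) (sigma y).
Proof. by move=> h i ni; apply: h. Qed.

(** [splice n x y] is the first [n] letters of [x] followed by [y]. *)
Definition splice n x y : configuration A :=
  fun i => if (i < n)%N then x i else y (i - n)%N.

Lemma splice_lt n x y i : (i < n)%N -> splice n x y i = x i.
Proof. by rewrite /splice => ->. Qed.

Lemma splice_ge n x y i : splice n x y (n + i)%N = y i.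
Proof. by rewrite /splice ltnNge leq_addr /= addKn. Qed.

Lemma agree_splice n x y : agree n (splice n x y) x.
Proof. by move=> i; apply: splice_lt. Qed.

Lemma iter_shift_splice n x y : iter n (@sigma A) (splice n x y) = y.
Proof. by apply/funext => i; rewrite iter_shiftE splice_ge. Qed.

Lemma splice_shift n x : splice n x (iter n (@sigma A) x) = x.
Proof.
apply/funext => i; case: (ltnP i n) => [/splice_lt->//|ni].
by rewrite -{1}(subnKC ni) splice_ge iter_shiftE subnKC.
Qed.

Lemma splice_of_agree n x y :
  agree n x y -> splice n x (iter n (@sigma A) y) = y.
Proof.
move=> xy; rewrite -{2}(splice_shift n y); apply/funext => i.
by rewrite /splice; case: ifP => // /xy.
Qed.

End Configurations.

(** * Subshifts of finite type and sofic shifts *)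

Section Subshifts.
Context {A : finType}.
Implicit Types (x y z : configuration A) (X Y : set (configuration A)).

Lemma eq_mkseq_agree n x y : mkseq x n = mkseq y n <-> agree n x y.
Proof.
split=> [h i ni|h]; last first.
  by apply/eq_in_map => i; rewrite mem_iota add0n => /h.
by have := congr1 (fun s => nth (x 0%N) s i) h; rewrite !nth_mkseq.
Qed.

Lemma occursP (w : seq A) x :
  occurs w x <-> exists i, mkseq (iter i (@sigma A) x) (size w) = w.
Proof. by split=> -[i h]; exists i; move: h; rewrite iter_shift. Qed.

(** A shift defined by a condition on the windows of a fixed length [k] is of
    finite type: the forbidden words are those of length [k] which start no
    sequence satisfying the condition. *)
Lemma SFT_local (k : nat) (Q : configuration A -> Prop) :
  (forall x y, agree k x y -> Q x -> Q y) ->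
  is_SFT [set x | forall i, Q (iter i (@sigma A) x)].
Proof.
move=> Qk; pose bad (t : k.-tuple A) := `[< forall x, Q x -> mkseq x k <> t >].
exists [seq tval t | t <- enum {: k.-tuple A} & bad t].
apply/seteqP; split=> x /= h.
  move=> w /mapP[t]; rewrite mem_filter => /andP[/asboolP bt _] ->.
  move=> /occursP[i]; rewrite size_tuple; exact: bt.
move=> i; apply: contrapT => nQ.
pose t := [tuple of mkseq (iter i (@sigma A) x) k].
have bt : bad t.
  apply/asboolP => y Qy /eq_mkseq_agree yx; apply: nQ; exact: Qk Qy.
apply: (h t); first by apply/mapP; exists t; rewrite // mem_filter bt mem_enum.
by apply/occursP; exists i; rewrite size_tuple.
Qed.

(** Two points of a shift of finite type which share a long enough word can be
    glued along this word. *)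
Lemma SFT_glue X : is_SFT X -> exists M, forall n x y,
  X x -> X y -> agree M (iter n (@sigma A) x) y -> X (splice n x y).
Proof.
move=> [F ->]; exists (\max_(w <- F) size w)%N => n x y Fx Fy xy w wF.
have wM : (size w <= \max_(w <- F) size w)%N by exact: leq_bigmax_seq.
move=> [i iw]; have [ni|ni] := leqP n i.
  apply: (Fy w wF); exists (i - n)%N; rewrite -{2}iw.
  apply/eq_in_map => j _; rewrite -[in RHS](subnKC ni) -addnA.
  by rewrite (splice_ge n x y (i - n + j)).
apply: (Fx w wF); exists i; rewrite -{2}iw.
apply/eq_in_map => j; rewrite mem_iota add0n => /andP[_ jw].
have [nij|nij] := ltnP (i + j) n; first by rewrite (splice_lt x y nij).
rewrite -(subnKC nij) (splice_ge n x y) -xy ?iter_shiftE //.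
by rewrite (leq_trans _ wM) // ltn_subLR // -addnS leq_add // ltnW.
Qed.

Lemma SFT_closed X x :
  is_SFT X -> (forall n, exists2 y, X y & agree n x y) -> X x.
Proof.
move=> [F ->] h w wF [i iw]; have [y /(_ w wF) ny xy] := h (i + size w)%N.
apply: ny; exists i; rewrite -{2}iw.
apply/eq_in_map => j; rewrite mem_iota add0n => /andP[_ jw].
by rewrite xy // ltn_add2l.
Qed.

Lemma SFT_shift X x n : is_SFT X -> X x -> X (iter n (@sigma A) x).
Proof.
move=> [F ->] h w wF /occursP[i iw]; apply: (h w wF); apply/occursP.
by exists (i + n)%N; rewrite iterD.
Qed.

Lemma continuous_relabel (B : finType) (f : B -> A) :
  continuous ((fun v i => f (v i)) : configuration B -> configuration A).
Proof.
move=> v U /nbhs_cylinder[n nU]; apply/nbhs_cylinder; exists n => w vw.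
by apply: nU => i /vw ->.
Qed.

Lemma SFT_sofic X : is_SFT X -> is_sofic X.
Proof.
move=> hX; exists A, X, id; split=> //; last by rewrite image_id.
by apply: continuous_subspaceT => x.
Qed.

End Subshifts.

Lemma nat_pigeonhole (T : finType) (f : nat -> T) :
  exists n m, (n < m)%N /\ f n = f m.
Proof.
apply: contrapT => h; pose g (i : 'I_#|T|.+1) := f i.
have /leq_card : injective g.
  move=> i j gij; apply/val_inj; case: (ltngtP i j) => // ij; exfalso; apply: h.
    by exists i, j.
  by exists j, i.
by rewrite card_ord ltnn.
Qed.

Section Sofic.
Context {A : finType}.

(** The labels of the infinite paths in a finite labelled graph form a sofic
    shift. *)
Lemma graph_sofic (V : finType) (e : V -> V -> Prop) (l : V -> A) :
  is_sofic [set x | exists v : nat -> V,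
    (forall i, e (v i) (v i.+1)) /\ forall i, x i = l (v i)].
Proof.
exists V, [set v | forall i, (fun u : configuration V => e (u 0%N) (u 1%N))
   (iter i (@sigma V) v)], (fun v i => l (v i)); split.
- apply: (@SFT_local _ 2 (fun u => e (u 0%N) (u 1%N))) => x y xy.
  by rewrite !xy.
- exact/continuous_subspaceT/continuous_relabel.
- by [].
- apply/seteqP; split=> [x [v /= hv <-]|x [v [hv xv]]].
    by exists v; split=> // i; have := hv i; rewrite !iter_shiftE addn0 addn1.
  exists v; last by apply/funext => i; rewrite xv.
  by move=> i; rewrite !iter_shiftE addn0 addn1.
Qed.


(** By compactness, the first letter of the image under a continuous map on a
    shift of finite type depends on a prefix of bounded length. *)
Lemma sofic_block_code (B : finType) (X : set (configuration B))
    (phi : configuration B -> configuration A) :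
  is_SFT X -> {within X, continuous phi} ->
  exists N, forall x y, X x -> X y -> agree N x y -> phi x 0%N = phi y 0%N.
Proof.
move=> hX /subspace_continuousP cphi; apply: contrapT => /forallNP h.
have {}h N : exists p : configuration B * configuration B,
    [/\ X p.1, X p.2, agree N p.1 p.2 & phi p.1 0%N <> phi p.2 0%N].
  apply: contrapT => k; apply: (h N) => x y Xx Xy xy; apply: contrapT => ne.
  by apply: k; exists (x, y).
have [u hu] := choice h.
have [x cx] := sequence_cluster (fun n => (u n).1).
have Xx : X x.
  apply: (SFT_closed hX) => n; have [m _ xm] := cx n 0%N.
  by exists (u m).1 => //; case: (hu m).
have := cphi x Xx [set y | agree 1 (phi x) y] (nbhs_agree _ _).
move=> /nbhs_cylinder[n nphi]; have [m nm xm] := cx n n.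
have [X1 X2 a12 ne] := hu m; apply: ne.
have e1 := nphi _ xm X1 0%N isT.
exact: etrans (esym e1) (nphi _ (agree_trans xm (agree_le nm a12)) X2 0%N isT).
Qed.

(** A sofic shift has finitely many follower sets, hence any sequence [x] has
    two distinct prefixes with the same follower set. *)
Lemma sofic_pigeonhole (Y : set (configuration A)) (x : configuration A) k :
  is_sofic Y -> exists n m, [/\ (k <= n)%N, (n < m)%N &
    forall z, Y (splice n x z) <-> Y (splice m x z)].
Proof.
move=> [B [X [phi [hX cphi com <-]]]].
have [M glue] := SFT_glue hX; have [N block] := sofic_block_code hX cphi.
have iphi i u : X u -> phi (iter i (@sigma B) u) = iter i (@sigma A) (phi u).
  move=> Xu; elim: i => // i IHi.
  by rewrite !iterS com ?IHi//; exact: SFT_shift.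
pose L := maxn M N.
pose P n := [set t : L.-tuple B | `[< exists u,
  [/\ X u, agree n (phi u) x & mkseq (iter n (@sigma B) u) L = t] >]]%SET.
have key n m z : P n = P m -> (phi @` X) (splice n x z) ->
    (phi @` X) (splice m x z).
  move=> Pnm [u Xu phiu].
  pose t := [tuple of mkseq (iter n (@sigma B) u) L].
  have : t \in P n.
    rewrite inE; apply/asboolP; exists u; split=> //.
    by rewrite phiu; exact: agree_splice.
  rewrite Pnm inE => /asboolP[u' [Xu' phiu' /eq_mkseq_agree uu']].
  (* a preimage of the exchanged sequence, glued from preimages of both parts *)
  have XL : X (splice m u' (iter n (@sigma B) u)).
    apply: glue => //; first exact: SFT_shift.
    by apply: agree_le uu'; rewrite leq_maxl.
  exists (splice m u' (iter n (@sigma B) u)) => //; apply/funext => i.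
  have -> : phi (splice m u' (iter n (@sigma B) u)) i =
      phi (iter i (@sigma B) (splice m u' (iter n (@sigma B) u))) 0%N.
    by rewrite iphi // iter_shiftE addn0.
  have [im|mi] := ltnP i m.
    rewrite (splice_lt x z im) -phiu' // (block _ (iter i (@sigma B) u')).
    - by rewrite iphi // iter_shiftE addn0.
    - exact: SFT_shift.
    - exact: SFT_shift.
    move=> j jN; rewrite !iter_shiftE.
    have [ij|ij] := ltnP (i + j) m; first exact: splice_lt.
    rewrite -(subnKC ij) splice_ge -uu' ?iter_shiftE //.
    by rewrite /L; lia.
  rewrite -(subnKC mi) (splice_ge m x z) addnC iterD iter_shift_splice -iterD.
  by rewrite iphi // iter_shiftE addn0 phiu addnC splice_ge.
have [n [m [nm Pnm]]] := nat_pigeonhole (fun n => P (k + n)%N).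
exists (k + n)%N, (k + m)%N; split; rewrite ?leq_addr ?ltn_add2l // => z.
by split; apply: key.
Qed.

End Sofic.

(** * Periodic sequences *)

Section Periodicity.
Context {A : finType}.
Implicit Types x : configuration A.

Lemma totally_periodicP x :
  totally_periodic x <-> exists2 p, (0 < p)%N & iter p (@sigma A) x = x.
Proof.
split=> [[a [w [w0 ->]]]|[p p0 px]].
  exists (size w); first by rewrite lt0n size_eq0.
  by apply/funext => i; rewrite iter_shiftE /omega modnDl.
exists (x 0%N), (mkseq x p); split; first by case: p p0 {px}.
have pkx k : iter (k * p) (@sigma A) x = x.
  by elim: k => // k IHk; rewrite mulSn iterD IHk px.
apply/funext => i; rewrite /omega size_mkseq nth_mkseq ?ltn_pmod //.
by rewrite {1}(divn_eq i p) -iter_shiftE pkx.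
Qed.

Lemma eventually_periodicP x : eventually_periodic x <->
  exists n m, (n < m)%N /\ iter n (@sigma A) x = iter m (@sigma A) x.
Proof.
split=> [[a [u [w [w0 ->]]]]|[n [m [nm xnm]]]].
  exists (size u), (size u + size w)%N; split.
    by rewrite -[ltnLHS]addn0 ltn_add2l lt0n size_eq0.
  apply/funext => i; rewrite !iter_shiftE /prepend.
  rewrite !ltnNge -!addnA !leq_addr /= !addKn.
  by rewrite /omega modnDl.
have /totally_periodicP[a [w [w0 xw]]] :
    exists2 p, (0 < p)%N & iter p (@sigma A) (iter n (@sigma A) x) =
      iter n (@sigma A) x.
  by exists (m - n)%N; rewrite ?subn_gt0 // -iterD subnK // ltnW.
exists a, (mkseq x n), w; split=> //; rewrite -xw; apply/funext => i.
rewrite /prepend size_mkseq; case: ltnP => ni; first by rewrite nth_mkseq.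
by rewrite iter_shiftE subnKC.
Qed.

Lemma totally_eventually_periodic x :
  totally_periodic x -> eventually_periodic x.
Proof.
move=> /totally_periodicP[p p0 px]; apply/eventually_periodicP.
by exists 0%N, p.
Qed.

End Periodicity.

(** * The lexicographic order *)

Section Lexicographic.
Context {k : nat}.
Local Notation conf := (configuration 'I_k.+1).
Local Notation sg := (@sigma 'I_k.+1).
Implicit Types (x y z : conf).

(** The letter of index [i], as a natural number. *)
Definition dig x i : nat := (x i : 'I_k.+1).

Lemma dig_inj x y i : dig x i = dig y i -> x i = y i.
Proof. by move=> h; apply: val_inj. Qed.

Lemma dig_iter n x i : dig (iter n sg x) i = dig x (n + i).
Proof. by rewrite /dig iter_shiftE. Qed.

(** The (non-strict) lexicographic order, in terms of the first difference. *)
Definition lex x y := forall n, agree n x y -> (dig x n <= dig y n)%N.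

Lemma lex_refl x : lex x x.
Proof. by move=> n _. Qed.

Lemma lex_antisym x y : lex x y -> lex y x -> x = y.
Proof.
move=> xy yx; apply: agree_eq; elim=> [//|n IHn] i.
rewrite ltnS leq_eqVlt => /orP[/eqP->|/IHn //].
apply: dig_inj; apply/eqP; rewrite eqn_leq xy //= yx //.
exact: agree_sym.
Qed.

Lemma lex_trans y x z : lex x y -> lex y z -> lex x z.
Proof.
move=> xy yz n xz; suff a : agree n x y.
  apply: leq_trans (xy n a) _; apply: yz.
  exact: agree_trans (agree_sym a) xz.
suff h m : (m <= n)%N -> agree m x y by exact: h.
elim: m => [//|m IHm mn] i.
have {}IHm := IHm (ltnW mn).
rewrite ltnS leq_eqVlt => /orP[/eqP->|/IHm //].
apply: dig_inj; apply/eqP; rewrite eqn_leq xy //=.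
rewrite [leqRHS]/dig xz //; apply: yz.
exact: agree_trans (agree_sym IHm) (agree_le (ltnW mn) xz).
Qed.

Lemma lex_lt n x y : agree n x y -> (dig x n < dig y n)%N -> lex x y.
Proof.
move=> a lt m am; case: (ltngtP m n) => [mn|nm|->]; last exact: ltnW.
  by rewrite /dig a.
by move: lt; rewrite /dig am // ltnn.
Qed.

Lemma lex_total x y : lex x y \/ lex y x.
Proof.
have [->|/first_difference[n [a ne]]] := pselect (x = y).
  by left; exact: lex_refl.
case: (ltngtP (dig x n) (dig y n)) => [h|h|/dig_inj //].
  by left; exact: lex_lt h.
by right; apply: lex_lt h; exact: agree_sym.
Qed.

Lemma agree_add n m x y :
  agree n x y -> agree m (iter n sg x) (iter n sg y) -> agree (n + m) x y.
Proof.
move=> a b i inm; case: (ltnP i n) => [/a//|ni].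
by have := b (i - n)%N; rewrite !iter_shiftE subnKC // => -> //; lia.
Qed.

Lemma agree_iter n m x y :
  agree (n + m) x y -> agree m (iter n sg x) (iter n sg y).
Proof. by move=> a i im; rewrite !iter_shiftE a // ltn_add2l. Qed.

Lemma lex_iter n x y : agree n x y ->
  (lex x y <-> lex (iter n sg x) (iter n sg y)).
Proof.
move=> a; split=> h m am.
  by rewrite !dig_iter; apply: h; exact: agree_add.
have [mn|nm] := ltnP m n; first by rewrite /dig a.
rewrite -(subnKC nm) -!dig_iter; apply: h; apply: agree_iter.
by rewrite subnKC.
Qed.

Lemma lex_closed x d :
  (forall n, exists2 y, lex y d & agree n x y) -> lex x d.
Proof.
move=> h n xd; have [y yd xy] := h n.+1.
rewrite /dig xy //; apply: yd; apply: agree_trans xd.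
exact/agree_sym/agree_le/xy.
Qed.

(** The sequence [0^oo]. *)
Definition zeros : conf := fun=> ord0.

Lemma lex_zeros x : lex zeros x.
Proof. by []. Qed.

Lemma iter_zeros n : iter n sg zeros = zeros.
Proof. by apply/funext => i; rewrite iter_shiftE. Qed.

(** [ends_zero x]: the sequence [x] has the form [u0^oo]. *)
Definition ends_zero x := exists n, iter n sg x = zeros.

Lemma ends_zero_iter n x : ends_zero (iter n sg x) <-> ends_zero x.
Proof.
split=> -[m h]; first by exists (m + n)%N; rewrite iterD.
by exists m; rewrite -iterD addnC iterD h iter_zeros.
Qed.

(** The sequence [0^m10^oo], provided that 1 is a letter. *)
Definition pulse m : conf := fun i => inord (i == m).

Lemma iter_pulse n m : iter n sg (pulse (n + m)) = pulse m.
Proof. by apply/funext => i; rewrite iter_shiftE /pulse eqn_add2l. Qed.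

Lemma agree_pulse m : agree m zeros (pulse m).
Proof.
move=> i im; apply: dig_inj; rewrite /dig /pulse /= inordK ?ltn_eqF //.
Qed.

Lemma ends_zero_pulse m : ends_zero (pulse m).
Proof.
exists m.+1; apply/funext => i; rewrite iter_shiftE.
apply: (@dig_inj _ zeros) => //.
by rewrite /dig /pulse gtn_eqF ?leq_addr // inordK.
Qed.

End Lexicographic.

Arguments zeros {k}.
Arguments pulse {k} m.

(** * Admissible sequences *)

(** [admissible d] is the set of the sequences all of whose shifts are
    lexicographically at most [d]. *)
Definition admissible k (d : configuration 'I_k.+1) :
    set (configuration 'I_k.+1) :=
  [set x | forall i, lex (iter i (@sigma 'I_k.+1) x) d].

Section Admissible.
Context {k : nat} (d : configuration 'I_k.+1).
Local Notation conf := (configuration 'I_k.+1).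
Local Notation sg := (@sigma 'I_k.+1).
Hypothesis dadm : admissible d d.
Hypothesis dpos : ~ ends_zero d.
Implicit Types (x y z : conf).

Lemma adm_iter n x : admissible d x -> admissible d (iter n sg x).
Proof. by move=> h i; rewrite -iterD. Qed.

Lemma adm_lex x : admissible d x -> lex x d.
Proof. by move=> /(_ 0%N). Qed.

Lemma adm_closed x :
  (forall n, exists2 y, admissible d y & agree n x y) -> admissible d x.
Proof.
move=> h i; apply: lex_closed => n; have [y yd xy] := h (i + n)%N.
by exists (iter i sg y) => //; exact: agree_iter.
Qed.

(** Lowering a tail of an admissible sequence keeps it admissible. *)
Lemma adm_tail n x y : admissible d x -> agree n x y ->
  admissible d (iter n sg y) -> lex (iter n sg y) (iter n sg x) ->
  admissible d y.
Proof.
move=> xd xy yd yx i; have [ni|iN] := leqP n i.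
  by rewrite -(subnK ni) iterD; exact: yd.
apply: lex_trans (xd i); apply/(@lex_iter _ (n - i)).
  by apply: agree_iter; rewrite subnKC; [exact: agree_sym|exact: ltnW].
by rewrite -!iterD subnK // ltnW.
Qed.

Lemma adm_splice n x y : admissible d x -> admissible d y ->
  lex y (iter n sg x) -> admissible d (splice n x y).
Proof.
move=> xd yd yx; apply: (@adm_tail n x); rewrite ?iter_shift_splice //.
exact/agree_sym/agree_splice.
Qed.

Lemma iter_not_zeros n : iter n sg d <> zeros.
Proof. by move=> h; apply: dpos; exists n. Qed.

Lemma dig0_gt0 : (0 < dig d 0)%N.
Proof.
rewrite lt0n; apply/eqP => d0; apply: (@iter_not_zeros 0).
apply/funext => i; apply: (@dig_inj _ _ zeros); apply/eqP.
rewrite [X in _ == X]/dig /= -leqn0 -d0.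
by have := @dadm i; move=> /(_ 0%N); rewrite dig_iter addn0; apply.
Qed.

Lemma letters_gt0 : (0 < k)%N.
Proof. by apply: leq_trans dig0_gt0 _; rewrite -ltnS; exact: ltn_ord. Qed.

Lemma adm_cons x :
  (dig x 0 < dig d 0)%N -> admissible d (sg x) -> admissible d x.
Proof.
move=> x0 xd [|i]; last by rewrite iterSr; exact: xd.
by apply: (@lex_lt _ 0).
Qed.

Lemma adm_zeros : admissible d zeros.
Proof. by move=> i; rewrite iter_zeros; exact: lex_zeros. Qed.

Lemma dig_pulse m : dig (@pulse k m) m = 1%N.
Proof. by rewrite /dig /pulse eqxx inordK // ltnS letters_gt0. Qed.

(** A sequence [a0^oo] is admissible as soon as [a] is at most the first letter
    of [d]. *)
Lemma adm_cons_zeros x :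
  (dig x 0 <= dig d 0)%N -> sg x = zeros -> admissible d x.
Proof.
move=> x0 xz [|i]; last by rewrite iterSr xz; exact: adm_zeros.
case: (ltngtP (dig x 0) (dig d 0)) x0 => // x0 _; first exact: (@lex_lt _ 0).
apply/(@lex_iter _ 1) => [[]//|]; first by move=> _; exact: dig_inj.
by rewrite /= xz; exact: lex_zeros.
Qed.

Lemma adm_pulse m : admissible d (pulse m).
Proof.
elim: m => [|m IHm].
  apply: adm_cons_zeros; first by rewrite dig_pulse dig0_gt0.
  apply/funext => i; apply: (@dig_inj _ _ zeros).
  by rewrite /dig /sigma /pulse inordK.
apply: adm_cons; last by rewrite -[sg _]/(iter 1 sg _) (@iter_pulse _ 1 m).
by rewrite {1}/dig /pulse inordK // dig0_gt0.
Qed.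

Lemma adm_truncate n x : admissible d x -> admissible d (splice n x zeros).
Proof.
by move=> xd; apply: adm_splice; [|exact: adm_zeros|exact: lex_zeros].
Qed.

Lemma ends_zero_splice n x y : ends_zero (splice n x y) <-> ends_zero y.
Proof. by rewrite -(ends_zero_iter n) iter_shift_splice. Qed.

(** Since [d] does not end in zeros, a word followed by zeros is strictly below
    [d], and remains so after a digit 1 is inserted far to the right. *)
Lemma adm_splice_pulse n x : admissible d x ->
  exists N, forall m, (N <= m)%N -> admissible d (splice n x (pulse m)).
Proof.
elim: n x => [|n IHn] x xd.
  exists 0%N => m _; rewrite (_ : splice 0 x (pulse m) = pulse m).
    exact: adm_pulse.
  by apply/funext => i; rewrite -[in LHS](add0n i) splice_ge.
have [N hN] := IHn (sg x) (@adm_iter 1 x xd).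
have xz : splice n.+1 x zeros <> d.
  by move=> e; apply: dpos; rewrite -e ends_zero_splice; exists 0%N.
have [j [aj nj]] := first_difference xz.
exists (maxn N j) => m; rewrite geq_max => /andP[Nm jm] [|i]; last first.
  rewrite iterSr (_ : sg (splice n.+1 x (pulse m)) = splice n (sg x) (pulse m)).
    exact: hN.
  by apply/funext => l; rewrite /sigma /splice ltnS subSS.
have a : agree (n.+1 + m) (splice n.+1 x zeros) (splice n.+1 x (pulse m)).
  apply: agree_add; last by rewrite !iter_shift_splice; exact: agree_pulse.
  exact/(agree_trans (@agree_splice _ _ _ _))/agree_sym/agree_splice.
have jnm : (j < n.+1 + m)%N by lia.
move=> l la; have [lj|jl] := leqP l j.
  have : (dig (splice n.+1 x zeros) l <= dig d l)%N.
    by apply: (adm_lex (@adm_truncate n.+1 x xd)) => i il; apply: aj; lia.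
  by rewrite {1}/dig a //; lia.
by case: nj; rewrite a //; exact: la.
Qed.

End Admissible.

(** * Finite type and soficity of the admissible sequences *)

Section AdmissibleShift.
Context {k : nat} (d : configuration 'I_k.+1).
Local Notation conf := (configuration 'I_k.+1).
Local Notation sg := (@sigma 'I_k.+1).
Hypothesis dadm : admissible d d.
Implicit Types (x y z : conf).

(** When [d] has period [p], a sequence is admissible as soon as its words of
    length [p] are at most the first one of [d]: a longer comparison with [d]
    reduces to a shorter one after [p] letters. *)
Lemma adm_SFT : totally_periodic d -> is_SFT (admissible d).
Proof.
move=> /totally_periodicP[p p0 dp].
pose Q (y : conf) := forall n, (n < p)%N -> agree n y d ->
  (dig y n <= dig d n)%N.
have -> : admissible d = [set x | forall i, Q (iter i sg x)].
  apply/seteqP; split=> [x xd i n _|x /= h i n]; first exact: (xd i).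
  elim/ltn_ind: n i => n IHn i a; have [np|pn] := ltnP n p; first exact: h.
  have a' : agree (n - p) (iter (p + i) sg x) d.
    by rewrite -dp iterD; apply: agree_iter; rewrite subnKC.
  have np : (n - p < n)%N by rewrite ltn_subrL p0 (leq_trans p0 pn).
  have := IHn _ np _ a'; rewrite !dig_iter (addnC p) -addnA subnKC //.
  suff -> : dig d (n - p) = dig d n by [].
  by rewrite -{1}dp dig_iter subnKC.
apply: (@SFT_local _ p Q) => x y xy h n np ny.
rewrite -[leqLHS]/(nat_of_ord (y n : 'I_k.+1)) -(xy n np); apply: h => //.
exact: agree_trans (agree_le (ltnW np) xy) ny.
Qed.

(** If [admissible d] is of finite type with memory [M], take the longest
    [j <= M] such that the [j] letters of [d] before position [M.+1] form a
    prefix of [d]: the follower set of the prefix of length [M.+1] then has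
    greatest element both [sigma^j d] and [sigma^(M+1) d]. *)
Lemma SFT_adm : is_SFT (admissible d) -> totally_periodic d.
Proof.
move=> /SFT_glue[M glue]; set n := M.+1.
pose P j := (j <= M)%N && `[< agree j (iter (n - j) sg d) d >].
have exP : exists j, P j by exists 0%N; rewrite /P; apply/asboolP.
have ubP j : P j -> (j <= M)%N by case/andP.
case: (ex_maxnP exP ubP) => j /andP[jM /asboolP aj] jmax.
have jn : (j <= n)%N by rewrite (leq_trans jM).
have nj0 : (0 < n - j)%N by rewrite subn_gt0 ltnS.
apply/totally_periodicP; exists (n - j)%N => //.
(* the word d_0...d_M followed by sigma^j d *)
pose W := splice n d (iter j sg d).
have Wj : iter (n - j) sg W = d.
  rewrite -[RHS](splice_of_agree aj) -(splice_shift j (iter (n - j) sg W)).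
  rewrite -iterD subnKC // iter_shift_splice; apply/funext => i.
  rewrite /splice; case: ifP => // ij; rewrite !iter_shiftE.
  by apply: splice_lt; rewrite -ltn_subRL subKn.
have W_adm : admissible d (sg W).
  move=> i; rewrite -iterSr; have [ji|ij] := leqP (n - j) i.+1.
    by rewrite -(subnK ji) iterD Wj; exact: dadm.
  have [l [ln al nl]] : exists l, [/\ (l < n - i.+1)%N,
      agree l (iter i.+1 sg d) d & iter i.+1 sg d l <> d l].
    have na : ~ agree (n - i.+1) (iter i.+1 sg d) d.
      move=> a; have : (n - i.+1 <= j)%N.
        apply: jmax; rewrite /P leq_subLR /n addSn ltnS leq_addl /=.
        apply/asboolP; rewrite subKn //; lia.
      by lia.
    have [|l [al nl]] := @first_difference _ (iter i.+1 sg d) d.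
      by move=> e; apply: na; rewrite e.
    exists l; split=> //; rewrite ltnNge; apply/negP => h; apply: na.
    exact: agree_le al.
  have aW : agree (n - i.+1) (iter i.+1 sg W) (iter i.+1 sg d).
    by apply: agree_iter; rewrite subnKC; [exact: agree_splice|lia].
  apply: (@lex_lt _ l); first exact: agree_trans (agree_le (ltnW ln) aW) al.
  have -> : dig (iter i.+1 sg W) l = dig (iter i.+1 sg d) l.
    by rewrite {1}/dig aW.
  rewrite ltn_neqAle (@dadm i.+1) // andbT.
  by apply/eqP => /dig_inj.
have W1 : splice 1 d (sg W) = W.
  by rewrite -[RHS](splice_shift 1) ; apply/funext => -[].
have WS : admissible d W.
  rewrite -W1; apply: glue => //= i iM.
  by rewrite /sigma /W splice_lt.
have jd : iter j sg d = iter n sg d.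
  apply: lex_antisym.
    have /(lex_iter (@agree_splice _ n d (iter j sg d))) := adm_lex WS.
    by rewrite iter_shift_splice.
  have /(lex_iter aj) := @dadm (n - j).
  by rewrite -iterD subnKC.
rewrite -[RHS](splice_of_agree aj) jd.
by rewrite -[LHS](splice_shift j) -iterD subnKC.
Qed.

(** The greatest follower of the prefix of length [n] of [d] is [sigma^n d], so
    two prefixes with the same followers give two equal shifts of [d]. *)
Lemma sofic_adm : is_sofic (admissible d) -> eventually_periodic d.
Proof.
move=> /(sofic_pigeonhole d 0)[n [m [_ nm h]]].
apply/eventually_periodicP; exists n, m; split=> //.
apply: lex_antisym.
  have /h hd : admissible d (splice n d (iter n sg d)) by rewrite splice_shift.
  have /(lex_iter (@agree_splice _ m d (iter n sg d))) := adm_lex hd.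
  by rewrite iter_shift_splice.
have /h hd : admissible d (splice m d (iter m sg d)) by rewrite splice_shift.
have /(lex_iter (@agree_splice _ n d (iter m sg d))) := adm_lex hd.
by rewrite iter_shift_splice.
Qed.

Lemma eventually_periodic_orbit : eventually_periodic d ->
  exists m (r : nat -> 'I_m.+1), forall j, iter (r j) sg d = iter j sg d.
Proof.
move=> /eventually_periodicP[n [m' [nm dnm]]].
case: m' => [//|m] in nm dnm *; exists m.
suff /choice[r hr] : forall j, exists i : 'I_m.+1, iter i sg d = iter j sg d.
  by exists r.
elim=> [|j [i ij]]; first by exists ord0.
have [im|mi] := ltnP i m.
  have im' : (i.+1 < m.+1)%N by rewrite ltnS.
  by exists (Ordinal im'); rewrite !iterS ij.
have im : (i = m :> nat) by apply/eqP; rewrite eqn_leq mi -ltnS ltn_ord.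
exists (Ordinal nm); rewrite [LHS]dnm !iterS -ij im //.
Qed.

(** A state of the graph which recognizes [admissible d] records the tail of
    [d] against which the rest of the sequence is compared. *)
Lemma adm_sofic : eventually_periodic d -> is_sofic (admissible d).
Proof.
move=> /eventually_periodic_orbit[m [r hr]].
pose e (s t : 'I_m.+1 * 'I_k.+1) :=
  ((s.2 < dig d s.1)%N /\ iter t.1 sg d = d) \/
  (nat_of_ord s.2 = dig d s.1 /\ iter t.1 sg d = iter s.1.+1 sg d).
have -> : admissible d = [set x | exists v : nat -> 'I_m.+1 * 'I_k.+1,
    (forall i, e (v i) (v i.+1)) /\ forall i, x i = snd (v i)].
  apply/seteqP; split=> [x xd|x [v [ev xv]] i]; last first.
    apply: (@lex_trans _ (iter (v i).1 sg d)); last exact: dadm.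
    move=> n; elim: n i => [|n IHn] i a.
      rewrite !dig_iter !addn0 /dig xv.
      by case: (ev i) => -[]; [move=> /ltnW|move=> ->].
    have xi : dig x i = dig d (v i).1.
      by have := a 0%N isT; rewrite !iter_shiftE !addn0 /dig => ->.
    case: (ev i) => -[]; first by rewrite -xi /dig xv ltnn.
    move=> _ vS; have := IHn i.+1; rewrite vS.
    rewrite !dig_iter !addSnnS; apply => l ln.
    by have := a l.+1; rewrite !iter_shiftE !addSnnS; apply.
  (* the length of the prefix of [d] which is being matched *)
  pose t := fix t i := if i is i'.+1 then
    if (dig x i' < dig d (t i'))%N then 0%N else (t i').+1 else 0%N.
  have inv i : (t i <= i)%N /\ agree (t i) (iter (i - t i) sg x) d.
    elim: i => //= i [ti a]; case: ifP => // lt; split=> //.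
    rewrite subSS => l; rewrite ltnS leq_eqVlt => /orP[/eqP->|/a //].
    apply: dig_inj; apply/eqP; rewrite eqn_leq xd //=.
    by rewrite dig_iter subnK // leqNgt lt.
  exists (fun i => (r (t i), x i : 'I_k.+1)); split=> // i.
  have dr j : dig d (r j) = dig d j.
    by rewrite -[r j : nat]addn0 -dig_iter hr dig_iter addn0.
  have [ti a] := inv i; rewrite /e /= !hr dr.
  case: ifP => lt; [by left|right]; split=> //.
  apply/eqP; rewrite eqn_leq; apply/andP; split.
    by have := xd _ _ a; rewrite dig_iter subnK.
  by rewrite leqNgt; exact: negbT lt.
exact: graph_sofic.
Qed.

End AdmissibleShift.

Local Open Scope ring_scope.

(** * The value of a digit sequence *)

Section Values.
Context {R : realType} {beta : R} (beta1 : 1 < beta).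
Local Notation conf := (configuration 'I_(Num.truncn beta).+1).
Local Notation sg := (@sigma 'I_(Num.truncn beta).+1).
Implicit Types (x y z : conf).

Lemma beta_gt0 : 0 < beta. Proof. exact: lt_trans ltr01 beta1. Qed.

Lemma beta_neq0 : beta != 0. Proof. exact: lt0r_neq0 beta_gt0. Qed.

Lemma norm_inv_beta_lt1 : `|beta^-1| < 1.
Proof.
by rewrite ger0_norm ?invr_ge0 ?(ltW beta_gt0) // invf_lt1 ?beta_gt0.
Qed.

Lemma expr_bounded_le0 (a C : R) : (forall n, beta ^+ n * a <= C) -> a <= 0.
Proof.
move=> h; rewrite leNgt; apply/negP => a0.
have C0 : 0 < C by apply: lt_le_trans (h 0%N); rewrite mul1r.
have /cvgrPdist_lt/(_ a a0)[N _ /(_ N (leqnn N))] :=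
  cvg_geometric C norm_inv_beta_lt1.
rewrite /geometric /= sub0r normrN ger0_norm; last first.
  by rewrite mulr_ge0 ?exprn_ge0 ?invr_ge0 ?(ltW beta_gt0) ?(ltW C0).
rewrite exprVn ltr_pdivrMr ?exprn_gt0 ?beta_gt0 //.
by rewrite mulrC ltNge h.
Qed.

(** The partial sums of the series which defines the value of [x]. *)
Definition digit_sum n x : R :=
  \sum_(0 <= i < n) (dig x i)%:R * beta ^- i.+1.

Lemma digit_sum_recl n x :
  digit_sum n.+1 x = ((dig x 0)%:R + digit_sum n (sg x)) / beta.
Proof.
rewrite /digit_sum big_nat_recl // expr1 mulrDl; congr (_ + _).
rewrite mulr_suml; apply: eq_bigr => i _.
by rewrite exprSr invfM mulrA.
Qed.

(** The largest value of a digit sequence without any admissibility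
    condition. *)
Definition value_bound : R := (Num.truncn beta)%:R / (beta - 1).

Lemma value_bound_ge0 : 0 <= value_bound.
Proof. by rewrite divr_ge0 // subr_ge0 ltW. Qed.

Lemma digit_sum_bound n x : 0 <= digit_sum n x <= value_bound.
Proof.
elim: n x => [|n IHn] x.
  by rewrite /digit_sum big_geq // lexx value_bound_ge0.
have /andP[s0 sB] := IHn (sg x); rewrite digit_sum_recl.
rewrite divr_ge0 ?addr_ge0 ?(ltW beta_gt0) //=.
rewrite ler_pdivrMr ?beta_gt0 //.
have -> : value_bound * beta = (Num.truncn beta)%:R + value_bound.
  by rewrite /value_bound; field; rewrite subr_eq0 gt_eqF.
by apply: lerD => //; rewrite ler_nat -ltnS; exact: ltn_ord.
Qed.

Lemma digit_sum_cvg x : cvgn (digit_sum^~ x).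
Proof.
apply: nondecreasing_is_cvgn.
  apply/nondecreasing_seqP => n; rewrite /digit_sum big_nat_recr //= lerDl.
  by rewrite mulr_ge0 // invr_ge0 exprn_ge0 // ltW // beta_gt0.
by exists value_bound => _ [n _ <-]; case/andP: (digit_sum_bound n x).
Qed.

Lemma real_of_cvg x : digit_sum^~ x @ \oo --> real_of beta x.
Proof. exact: digit_sum_cvg. Qed.

Lemma real_of_bound x : 0 <= real_of beta x <= value_bound.
Proof.
apply/andP; split.
  apply: limr_ge; first exact: digit_sum_cvg.
  by apply: nearW => n; case/andP: (digit_sum_bound n x).
apply: limr_le; first exact: digit_sum_cvg.
by apply: nearW => n; case/andP: (digit_sum_bound n x).
Qed.

Lemma real_of_ge0 x : 0 <= real_of beta x.
Proof. by case/andP: (real_of_bound x). Qed.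

Lemma real_ofE x :
  beta * real_of beta x = (dig x 0)%:R + real_of beta (sg x).
Proof.
suff -> : real_of beta x = ((dig x 0)%:R + real_of beta (sg x)) / beta.
  by rewrite mulrC divfK ?beta_neq0.
have c1 : digit_sum^~ x \o S @ \oo --> real_of beta x.
  by have := @real_of_cvg x; rewrite -cvg_shiftS.
apply: (cvg_unique _ c1) => //.
have -> : digit_sum^~ x \o S =
    (fun n => ((dig x 0)%:R + digit_sum n (sg x)) / beta).
  by apply/funext => n; rewrite /= digit_sum_recl.
apply: cvgMl; apply: cvgD; first exact: cvg_cst.
exact: real_of_cvg.
Qed.

Lemma real_of_iterE n x : beta * real_of beta (iter n sg x) =
  (dig x n)%:R + real_of beta (iter n.+1 sg x).
Proof. by rewrite real_ofE dig_iter addn0. Qed.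

Lemma real_of_agree n x y : agree n x y ->
  beta ^+ n * (real_of beta x - real_of beta y) =
  real_of beta (iter n sg x) - real_of beta (iter n sg y).
Proof.
elim: n => [|n IHn] a; first by rewrite mul1r.
rewrite exprS -mulrA IHn; last exact: agree_le a.
by rewrite mulrBr !real_of_iterE {1}/dig a // opprD addrACA subrr add0r.
Qed.

Lemma real_of_continuous : continuous (real_of beta : conf -> R).
Proof.
move=> x U /nbhs_ballP[e /= e0 eU].
have /cvgrPdist_lt/(_ e e0)[N _ /(_ N (leqnn N))] :=
  cvg_geometric value_bound norm_inv_beta_lt1.
rewrite /geometric /= sub0r normrN exprVn => hN.
apply/nbhs_cylinder; exists N => y xy; apply: eU.
rewrite /ball /=.
have bN : 0 < beta ^+ N by rewrite exprn_gt0 // beta_gt0.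
apply: le_lt_trans (le_lt_trans (ler_norm _) hN).
rewrite ler_pdivlMr // mulrC -[X in X * _]gtr0_norm // -normrM.
rewrite real_of_agree // ler_norml.
have := real_of_bound (iter N sg x); have := real_of_bound (iter N sg y).
by lra.
Qed.

(** A bounded sequence of remainders computes the values of all the shifts. *)
Lemma real_of_unique x (r : nat -> R) (r01 : forall i, 0 <= r i <= 1)
    (rE : forall i, beta * r i = (dig x i)%:R + r i.+1) n :
  real_of beta (iter n sg x) = r n.
Proof.
have h m : beta ^+ m * (real_of beta (iter n sg x) - r n) =
    real_of beta (iter (m + n) sg x) - r (m + n)%N.
  elim: m => [|m IHm]; first by rewrite mul1r.
  by rewrite exprS -mulrA IHm mulrBr rE real_of_iterE opprD addrACA subrr add0r.
apply/eqP; rewrite -subr_eq0 eq_le -[X in _ && X]oppr_le0; apply/andP; split.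
  apply: (@expr_bounded_le0 _ value_bound) => m; rewrite h.
  have := real_of_bound (iter (m + n) sg x); have := r01 (m + n)%N.
  by lra.
apply: (@expr_bounded_le0 _ 1) => m; rewrite mulrN h.
have := real_of_ge0 (iter (m + n) sg x); have := r01 (m + n)%N.
by lra.
Qed.

Lemma real_of_zeros : real_of beta zeros = 0.
Proof.
rewrite -[zeros](iter_zeros 0).
apply: (@real_of_unique _ (fun=> 0)) => i; first by rewrite lexx ler01.
by rewrite mulr0 addr0.
Qed.

Lemma real_of_eq0 x : real_of beta x = 0 -> x = zeros.
Proof.
move=> x0; apply/funext => i; apply: (@dig_inj _ _ zeros).
have h n : real_of beta (iter n sg x) = 0.
  elim: n => // n IHn; have := real_of_iterE n x; rewrite IHn mulr0.
  have := real_of_ge0 (iter n.+1 sg x); have := ler0n R (dig x n).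
  by lra.
apply/eqP; rewrite -[_ == _]/(dig x i == 0%N) -(eqr_nat R).
by have := real_of_iterE i x; rewrite !h mulr0 addr0 => <-.
Qed.

(** Expansions of two numbers with remainders [r] and [s] are ordered as the
    numbers, provided ties are excluded by a strict inequality. *)
Lemma lex_remainders x y (r s : nat -> R)
    (rE : forall i, beta * r i = (dig x i)%:R + r i.+1)
    (sE : forall i, beta * s i = (dig y i)%:R + s i.+1) :
  (forall i, 0 <= r i) -> (forall i, s i <= 1) -> r 0%N <= s 0%N ->
  r 0%N < s 0%N \/ (forall i, 0 < r i) -> lex x y.
Proof.
move=> r0 s1 rs0 strict n xy.
have e m : (m <= n)%N -> r m - s m = beta ^+ m * (r 0%N - s 0%N).
  elim: m => [_|m IHm mn]; first by rewrite mul1r.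
  rewrite exprS -mulrA -(IHm (ltnW mn)) mulrBr rE sE {1}/dig xy //.
  by rewrite opprD addrACA subrr add0r.
have bn : 0 < beta ^+ n by rewrite exprn_gt0 // beta_gt0.
rewrite -ltnS -(ltr_nat R) -[X in _ < X]natr1.
have := rE n; have := sE n; have := s1 n.+1; have := r0 n.+1.
have rsn := e n (leqnn n).
case: strict => [lt|pos].
  have : beta * (r n - s n) < 0.
    by rewrite pmulr_rlt0 ?beta_gt0 // rsn pmulr_rlt0 // subr_lt0.
  by rewrite mulrBr; lra.
have : beta * (r n - s n) <= 0.
  by rewrite pmulr_rle0 ?beta_gt0 // rsn pmulr_rle0 // subr_le0.
by rewrite mulrBr; have := pos n.+1; lra.
Qed.

End Values.

(** * Lexicographic description of the beta-shift *)

Section Parry.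
Context {R : realType} {beta : R} (beta1 : 1 < beta).
Local Notation conf := (configuration 'I_(Num.truncn beta).+1).
Local Notation sg := (@sigma 'I_(Num.truncn beta).+1).
Local Notation T := (beta_map beta).
Local Notation d := (quasi_expansion_one beta).
Implicit Types (x y z : conf).

Let b0 : 0 < beta := beta_gt0 beta1.

Lemma beta_mapE (r : R) :
  0 <= r -> beta_map beta r = beta * r - (Num.truncn (beta * r))%:R.
Proof.
move=> r0; have br0 : 0 <= beta * r by rewrite mulr_ge0 // ltW.
rewrite /beta_map truncn_floor br0; congr (_ - _).
by rewrite -[RHS]/((Posz _)%:~R) gez0_abs // floor_ge0.
Qed.

Lemma iter_beta_map_lt1 (r : R) i : 0 <= r < 1 -> 0 <= iter i T r < 1.
Proof.
move=> r01; elim: i => // i /andP[t0 t1].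
have bt0 : 0 <= beta * iter i T r by rewrite mulr_ge0 // ltW.
rewrite iterS beta_mapE // subr_ge0 truncn_le bt0 /= ltrBlDr.
by have := truncnS_gt (beta * iter i T r); rewrite -natr1 addrC.
Qed.

Lemma beta_expansion_remainder (r : R) i : 0 <= r <= 1 ->
  beta * iter i T r = (dig (beta_expansion beta r) i)%:R + iter i.+1 T r.
Proof.
move=> r01; have /andP[t0 _] := @iter_beta_map_itv R beta _ i r01.
rewrite iterS beta_mapE // [dig _ _]beta_expansionE //.
by rewrite addrC subrK.
Qed.

Lemma real_of_beta_expansion (r : R) n : 0 <= r <= 1 ->
  real_of beta (iter n sg (beta_expansion beta r)) = iter n T r.
Proof.
move=> r01; apply: (@real_of_unique _ _ beta1 _ (fun i => iter i T r)) => i.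
  exact: iter_beta_map_itv.
exact: beta_expansion_remainder.
Qed.

Lemma dig_expansion_one0 : (0 < dig (beta_expansion beta 1) 0)%N.
Proof.
rewrite [dig _ _]beta_expansionE // ?ler01 ?lexx //= mulr1 truncn_gt0.
exact: ltW.
Qed.

(** The remainders of the quasi-greedy expansion of 1 lie in the half-open
    interval (0, 1]. *)
Lemma quasi_remainders : exists Y : nat -> R,
  [/\ Y 0%N = 1, forall n, 0 < Y n <= 1 &
      forall n, beta * Y n = (dig d n)%:R + Y n.+1].
Proof.
set t := beta_expansion beta 1.
have one : 0 <= (1 : R) <= 1 by rewrite ler01 lexx.
have tI i : 0 <= iter i T 1 <= 1 by exact: iter_beta_map_itv.
have tE i : beta * iter i T 1 = (dig t i)%:R + iter i.+1 T 1.
  exact: beta_expansion_remainder.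
(* a zero remainder is followed by zero digits *)
have pos m n : dig t m != 0%N -> (n <= m)%N -> 0 < iter n T 1.
  move=> tm nm; have /andP[t0 _] := tI n.
  rewrite lt_def t0 andbT; apply/eqP => tn; move/eqP: tm; apply.
  have z : iter n sg t = zeros.
    by apply: (@real_of_eq0 _ _ beta1); rewrite real_of_beta_expansion.
  by rewrite -(subnKC nm) -dig_iter z.
rewrite /d; case: asboolP => [ex|nex]; last first.
  exists (fun n => iter n T 1); split=> // n.
  have /andP[t0 ->] := tI n; rewrite andbT lt_def t0 andbT.
  have [m nm tm] : exists2 m, (n <= m)%N & dig t m != 0%N.
    apply: contrapT => h.
    have tz m : (n <= m)%N -> t m = ord0.
      move=> nm; apply: (@dig_inj _ _ zeros); apply/eqP.
      by apply: contrapT => /negP k; apply: h; exists m.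
    have : exists m, dig t m != 0%N.
      by exists 0%N; rewrite -lt0n dig_expansion_one0.
    have ub m : dig t m != 0%N -> (m <= n)%N.
      move=> tm; rewrite leqNgt; apply/negP => /ltnW nm.
      by move: tm; rewrite /dig tz.
    move=> /ex_maxnP/(_ ub)[m tm mmax]; apply: nex; exists m; split.
      by apply/eqP => tm0; move: tm; rewrite /dig /t tm0.
    move=> i mi; apply: (@dig_inj _ _ zeros); apply/eqP.
    by apply: contrapT => /negP/mmax; rewrite leqNgt mi.
  by rewrite gt_eqF // (pos m).
have := getPex ex; rewrite /=; set m := get _ => -[tm tz].
have tm0 : dig t m != 0%N.
  by apply: contra tm => /eqP tm; apply/eqP; exact: (@dig_inj _ _ zeros).
have Tm : iter m.+1 T 1 = 0.
  rewrite -real_of_beta_expansion // -/t (_ : iter _ _ _ = zeros).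
    exact: real_of_zeros.
  apply/funext => i; rewrite iter_shiftE; apply: tz.
  by rewrite addSn ltnS leq_addr.
(* lowering the last nonzero digit replaces the next remainder 0 by 1 *)
exists (fun n => iter (n %% m.+1)%N T 1); split; first by rewrite mod0n.
  move=> n; have /andP[_ ->] := tI (n %% m.+1)%N; rewrite andbT.
  by apply: (pos m) => //; rewrite -ltnS ltn_pmod.
move=> n; have nm : (n %% m.+1 <= m)%N by rewrite -ltnS ltn_pmod.
have nS : (n.+1 %% m.+1 = (n %% m.+1).+1 %% m.+1)%N.
  by rewrite -[n.+1]addn1 -[(n %% _).+1]addn1 modnDml.
rewrite tE [in RHS]/dig /omega size_rcons size_mkseq nth_rcons size_mkseq {}nS.
move: (n %% m.+1)%N nm => j; rewrite leq_eqVlt => /orP[/eqP ->|jm].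
  rewrite modnn ltnn eqxx Tm addr0 [iter 0 _ _]/= inordK; last first.
    by apply: leq_ltn_trans (leq_pred _) _; exact: ltn_ord.
  by rewrite natr1 prednK // lt0n.
by rewrite jm nth_mkseq // modn_small.
Qed.

Lemma real_of_quasi : exists Y : nat -> R, forall n,
  [/\ real_of beta (iter n sg d) = Y n, 0 < Y n & Y n <= 1].
Proof.
have [Y [_ Y01 YE]] := quasi_remainders; exists Y => n.
have /andP[Y0 Y1] := Y01 n; split=> //.
apply: (@real_of_unique _ _ beta1 _ Y) => // i.
by have /andP[/ltW -> ->] := Y01 i.
Qed.

Lemma real_of_iter_quasi_gt0 n : 0 < real_of beta (iter n sg d).
Proof. by have [Y /(_ n)[->]] := real_of_quasi. Qed.

Lemma real_of_iter_quasi_le1 n : real_of beta (iter n sg d) <= 1.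
Proof. by have [Y /(_ n)[->]] := real_of_quasi. Qed.

Lemma real_of_quasi1 : real_of beta d = 1.
Proof.
have [Y [Y1 Y01 YE]] := quasi_remainders; rewrite -Y1.
apply: (@real_of_unique _ _ beta1 _ Y _ _ 0) => // i.
by have /andP[/ltW -> ->] := Y01 i.
Qed.

Lemma quasi_not_ends_zero : ~ ends_zero d.
Proof.
move=> [n h]; have := real_of_iter_quasi_gt0 n.
by rewrite h real_of_zeros // ltxx.
Qed.

Lemma quasi_adm : admissible d d.
Proof.
move=> i; apply: (@lex_remainders _ _ beta1 _ _
  (fun n => real_of beta (iter (n + i) sg d))
  (fun n => real_of beta (iter n sg d))) => /=.
- by move=> n; rewrite real_of_iterE // dig_iter addnC.
- by move=> n; rewrite real_of_iterE.
- by move=> n; exact/ltW/real_of_iter_quasi_gt0.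
- exact: real_of_iter_quasi_le1.
- by rewrite real_of_quasi1; exact: real_of_iter_quasi_le1.
- by right=> n; exact: real_of_iter_quasi_gt0.
Qed.

Lemma beta_expansion_adm (r : R) :
  0 <= r < 1 -> admissible d (beta_expansion beta r).
Proof.
move=> r01; have r01' : 0 <= r <= 1 by case/andP: r01 => -> /ltW.
move=> i; apply: (@lex_remainders _ _ beta1 _ _
  (fun n => iter (n + i) T r) (fun n => real_of beta (iter n sg d))) => /=.
- move=> n; rewrite dig_iter (addnC i).
  exact: beta_expansion_remainder.
- by move=> n; rewrite real_of_iterE.
- by move=> n; case/andP: (iter_beta_map_lt1 (n + i) r01).
- exact: real_of_iter_quasi_le1.
- rewrite real_of_quasi1; apply: ltW.
  by case/andP: (iter_beta_map_lt1 i r01).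
- by left; rewrite real_of_quasi1; case/andP: (iter_beta_map_lt1 i r01).
Qed.

Lemma real_of_first_difference x y n : agree n x y ->
  beta ^+ n.+1 * (real_of beta x - real_of beta y) =
  (dig x n)%:R - (dig y n)%:R +
  (real_of beta (iter n.+1 sg x) - real_of beta (iter n.+1 sg y)).
Proof.
move=> a; rewrite exprS -mulrA real_of_agree // mulrBr !real_of_iterE //.
by rewrite opprD addrACA.
Qed.

(** The excess of the value over 1 is at most the excess for a later shift
    divided by a power of [beta]; iterating, it vanishes. *)
Lemma real_of_adm_le1 x : admissible d x -> real_of beta x <= 1.
Proof.
move=> xd.
have bn n : 0 < beta ^+ n by rewrite exprn_gt0.
have h N : forall y, admissible d y ->
    beta ^+ N * (real_of beta y - 1) <= value_bound (beta := beta).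
  elim: N => [|N IHN] y yd.
    rewrite mul1r; have /andP[_] := real_of_bound beta1 y; lra.
  have [->|/first_difference[n [a ne]]] := pselect (y = d).
    by rewrite real_of_quasi1 subrr mulr0 value_bound_ge0.
  have lt : (dig y n)%:R + 1 <= (dig d n)%:R :> R.
    rewrite natr1 ler_nat ltn_neqAle (adm_lex yd a) andbT.
    by apply/eqP => /dig_inj.
  have e : beta ^+ n.+1 * (real_of beta y - 1) <=
      real_of beta (iter n.+1 sg y) - 1.
    have := real_of_first_difference a; rewrite real_of_quasi1 => ->.
    have := real_of_iter_quasi_gt0 n.+1; lra.
  have [y1|/ltW y1] := leP (real_of beta y) 1.
    apply: le_trans (value_bound_ge0 beta1).
    by rewrite mulr_ge0_le0 ?exprn_ge0 ?subr_le0 // ltW.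
  apply: le_trans (IHN _ (@adm_iter _ _ n.+1 _ yd)).
  apply: le_trans (ler_wpM2l (ltW (bn N)) e).
  rewrite mulrA -exprD addnS exprS [X in _ <= X * _]exprS.
  rewrite exprD !mulrA [_ * beta ^+ n]mulrC -!mulrA ler_peMl //.
    by rewrite !mulr_ge0 ?subr_ge0 // ltW.
  by rewrite exprn_ege1 // ltW.
rewrite -subr_le0; apply: (@expr_bounded_le0 _ _ beta1) => N; exact: h.
Qed.

Lemma real_of_adm_eq1 x : admissible d x -> real_of beta x = 1 -> x = d.
Proof.
move=> xd x1; apply: contrapT => /first_difference[n [a ne]].
have lt : (dig x n)%:R + 1 <= (dig d n)%:R :> R.
  rewrite natr1 ler_nat ltn_neqAle (adm_lex xd a) andbT.
  by apply/eqP => /dig_inj.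
have := real_of_first_difference a.
rewrite real_of_quasi1 x1 subrr mulr0.
have := real_of_iter_quasi_gt0 n.+1.
have := real_of_adm_le1 (@adm_iter _ _ n.+1 _ xd).
by lra.
Qed.

(** The only coincidences between values of admissible sequences are
    [u(a+1)0^oo] and [uad], with [d] the quasi-greedy expansion of 1. *)
Lemma real_of_coincidence x y n : admissible d x -> admissible d y ->
  real_of beta x = real_of beta y -> agree n x y -> (dig x n < dig y n)%N ->
  [/\ dig y n = (dig x n).+1, iter n.+1 sg x = d & iter n.+1 sg y = zeros].
Proof.
move=> xd yd xy a lt.
have ltR : (dig x n)%:R + 1 <= (dig y n)%:R :> R by rewrite natr1 ler_nat.
have := real_of_first_difference a; rewrite xy subrr mulr0 => e.
have x1 := real_of_adm_le1 (@adm_iter _ _ n.+1 _ xd).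
have y0 := real_of_ge0 beta1 (iter n.+1 sg y).
split.
- apply/eqP; rewrite eqn_leq lt andbT -(ler_nat R) -natr1.
  by move: x1 y0 e; lra.
- apply: real_of_adm_eq1; first exact: adm_iter.
  by apply/eqP; rewrite eq_le x1 /=; move: ltR y0 e; lra.
- by apply: (real_of_eq0 beta1); move: ltR x1 y0 e; lra.
Qed.

Lemma real_of_twin x y n : agree n x y -> dig y n = (dig x n).+1 ->
  iter n.+1 sg x = d -> iter n.+1 sg y = zeros ->
  real_of beta x = real_of beta y.
Proof.
move=> a xy xd yz; apply/eqP; rewrite -subr_eq0.
have bn : beta ^+ n.+1 != 0 by rewrite expf_neq0 // gt_eqF.
rewrite -(mulrI_eq0 _ (mulfI bn)) real_of_first_difference // xd yz.
by rewrite real_of_quasi1 real_of_zeros // xy -natr1; apply/eqP; lra.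
Qed.

(** A value is taken by at most one admissible sequence which ends in zeros and
    by at most one which does not. *)
Lemma real_of_inj x y : admissible d x -> admissible d y ->
  real_of beta x = real_of beta y -> (ends_zero x <-> ends_zero y) -> x = y.
Proof.
move=> xd yd xy ez; apply: contrapT => /first_difference[n [a ne]].
have nd z : iter n.+1 sg z = d -> ~ ends_zero z.
  by move=> zd /(ends_zero_iter n.+1); rewrite zd; exact: quasi_not_ends_zero.
have ne0 z : iter n.+1 sg z = zeros -> ends_zero z by move=> h; exists n.+1.
case: (ltngtP (dig x n) (dig y n)) => [lt|lt|/dig_inj //].
  have [_ /nd xn /ne0 yn] := real_of_coincidence xd yd xy a lt.
  by apply: xn; apply/ez.
have [_ /nd yn /ne0 xn] :=
  real_of_coincidence yd xd (esym xy) (agree_sym a) lt.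
by apply: yn; apply/ez.
Qed.

(** Admissible sequences no shift of which is [d] are greedy expansions. *)
Lemma adm_beta_expansion x : admissible d x ->
  (forall i, iter i sg x <> d) -> beta_expansion beta (real_of beta x) = x.
Proof.
move=> xd nd.
have lt1 i : real_of beta (iter i sg x) < 1.
  rewrite lt_neqAle real_of_adm_le1 ?andbT; last exact: adm_iter.
  by apply/eqP => /real_of_adm_eq1 h; apply: (nd i); apply/h/adm_iter.
have ge0 i := real_of_ge0 beta1 (iter i sg x).
have tr i : Num.truncn (beta * real_of beta (iter i sg x)) = dig x i.
  apply: truncn_def; rewrite real_of_iterE // -natr1.
  by rewrite lerDl ltrD2l ge0 lt1.
have it i : iter i T (real_of beta x) = real_of beta (iter i sg x).
  elim: i => // i IHi; rewrite iterS IHi beta_mapE // tr real_of_iterE //.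
  by rewrite addrC addKr.
apply/funext => i; apply: dig_inj.
rewrite [LHS]beta_expansionE ?it ?tr //.
by have := lt1 0%N; have := ge0 0%N => /= -> /ltW.
Qed.

(** Parry's description of the beta-shift. *)
Lemma beta_shiftE : beta_shift beta = admissible d.
Proof.
apply/seteqP; split=> x.
  move=> /closure_cylinder h; apply: adm_closed => n.
  have [_ [r + <-] rx] := h n; rewrite /= in_itv /= => r01.
  by exists (beta_expansion beta r) => //; exact: beta_expansion_adm.
move=> xd; apply/closure_cylinder => n.
have yd := @adm_truncate _ _ n _ xd.
set y := splice n x zeros in yd.
have ynd i : iter i sg y <> d.
  move=> e; apply: quasi_not_ends_zero; rewrite -e ends_zero_iter.
  by apply/ends_zero_splice; exists 0%N.
exists y; last exact/agree_sym/agree_splice.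
exists (real_of beta y); last exact: adm_beta_expansion.
rewrite /= in_itv /= real_of_ge0 // lt_neqAle real_of_adm_le1 // andbT.
by apply/eqP => /(real_of_adm_eq1 yd); exact: ynd 0%N.
Qed.

Lemma nat_beta_quasi_const : beta \is a Num.nat <-> sg d = d.
Proof.
have [Y [Y1 Y01 YE]] := quasi_remainders; split=> [/natrP[b bE]|dc].
  have h n : Y n = 1.
    elim: n => // n IHn; have := YE n; rewrite IHn mulr1 => e.
    have /andP[y0 y1] := Y01 n.+1; apply/eqP; rewrite eq_le y1 /=.
    have : (dig d n < b)%N.
      by rewrite -(ltr_nat R) -bE [X in _ < X]e ltrDl.
    by rewrite -(ler_nat R) -natr1 -bE; move: e; lra.
  have e n : (dig d n)%:R = beta - 1 by have := YE n; rewrite !h mulr1; lra.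
  apply/funext => i; apply: dig_inj; apply/eqP.
  by rewrite -(eqr_nat R) -[dig (sg d) i]/(dig d i.+1) !e.
apply/natrP; exists (dig d 0).+1.
have := real_of_iterE beta1 0 d; rewrite /= dc real_of_quasi1 mulr1 => e.
by rewrite -natr1; exact: e.
Qed.

End Parry.

(** * The beta-kernel *)

Lemma hausdorff_configurations (A : finType) :
  hausdorff_space (configuration A).
Proof. by apply: hausdorff_product => i; exact: discrete_hausdorff. Qed.

Lemma finite_closed_configurations (A : finType) (D : set (configuration A)) :
  finite_set D -> closed D.
Proof.
move: D; apply/accessible_finite_set_closed.
exact/hausdorff_accessible/hausdorff_configurations.
Qed.

Section Kernel.
Context {R : realType} {beta : R} (beta1 : 1 < beta).
Local Notation A := ('I_(Num.truncn beta).+1).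
Local Notation conf := (configuration A).
Local Notation sg := (@sigma A).
Local Notation d := (quasi_expansion_one beta).
Local Notation val := (real_of beta).
Implicit Types (x y z : conf).

Let d_adm : admissible d d := quasi_adm beta1.
Let d_pos : ~ ends_zero d := quasi_not_ends_zero beta1.

(** The closure of the orbit of [d], together with [0^oo]. *)
Definition core : set conf := closure (orbit_of d) `|` [set zeros].

(** The values of the points of [core]; the points with such a value form the
    only class of the kernel which may have more than two elements. *)
Definition core_value : set R := val @` core.

Lemma orbit_adm : orbit_of d `<=` admissible d.
Proof. by move=> _ [n _ <-]; exact: adm_iter. Qed.

Lemma core_adm : core `<=` admissible d.
Proof.
move=> x [/closure_cylinder h|->]; last exact: adm_zeros.
apply: adm_closed => n; have [y /orbit_adm yd xy] := h n.
by exists y.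
Qed.

Lemma core_orbit n : core (iter n sg d).
Proof. by left; apply: subset_closure; exists n. Qed.

Lemma core_shift x : core x -> core (sg x).
Proof.
move=> [/closure_cylinder h|->]; last by right; exact: (iter_zeros 1).
left; apply/closure_cylinder => n; have [_ [i _ <-] xi] := h n.+1.
by exists (iter i.+1 sg d); [exists i.+1|exact: agree_shift].
Qed.

Lemma core_value_quasi : core_value (val d).
Proof. by exists d => //; exact: (core_orbit 0). Qed.

Lemma core_value_zeros : core_value (val zeros).
Proof. by exists zeros => //; right. Qed.

Lemma core_value_closed : closed core_value.
Proof.
apply: compact_closed; first exact: Rhausdorff.
apply: continuous_compact.
  by apply: continuous_subspaceT => x; exact: real_of_continuous.
apply: (subclosed_compact _ (@compact_configurations A)) => //.
apply: closedU; first exact: closed_closure.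
by apply: finite_closed_configurations; exact: finite_set1.
Qed.

(** The explicit form of the beta-kernel, see [beta_kernelE]. *)
Definition kernel_rel : set (conf * conf) := [set p |
  [/\ admissible d p.1, admissible d p.2 &
     val p.1 = val p.2 \/ (core_value (val p.1) /\ core_value (val p.2))]].

(** Shifting two sequences of the same value either keeps the values equal, or
    yields [d] and [0^oo]. *)
Lemma shift_same_value x y : admissible d x -> admissible d y ->
  val x = val y ->
  val (sg x) = val (sg y) \/
  (core_value (val (sg x)) /\ core_value (val (sg y))).
Proof.
move=> xd yd xy; case: (ltngtP (dig x 0) (dig y 0)) => [lt|lt|eq].
- have a : agree 0 x y by [].
  have [_ /= -> ->] := real_of_coincidence beta1 xd yd xy a lt.
  by right; split; [exact: core_value_quasi|exact: core_value_zeros].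
- have a : agree 0 y x by [].
  have [_ /= -> ->] := real_of_coincidence beta1 yd xd (esym xy) a lt.
  by right; split; [exact: core_value_zeros|exact: core_value_quasi].
left; have := real_ofE beta1 x; rewrite xy real_ofE // eq.
by move/addrI.
Qed.

Lemma core_value_shift x : admissible d x ->
  core_value (val x) -> core_value (val (sg x)).
Proof.
move=> xd [c cc cx]; have := shift_same_value (core_adm cc) xd cx.
by case=> [<-|[]//]; exists (sg c) => //; exact: core_shift.
Qed.

Lemma kernel_rel_closed : closed kernel_rel.
Proof.
have cont1 : continuous (fun p : conf * conf => val p.1).
  move=> p; apply: (@continuous_comp _ _ _ fst val); first exact: cvg_fst.
  exact: real_of_continuous.
have cont2 : continuous (fun p : conf * conf => val p.2).
  move=> p; apply: (@continuous_comp _ _ _ snd val); first exact: cvg_snd.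
  exact: real_of_continuous.
have adm_cl : closed (admissible d : set conf).
  by move=> x /closure_cylinder h; exact: adm_closed.
have -> : kernel_rel = (fst @^-1` admissible d `&` snd @^-1` admissible d) `&`
   ((fun p : conf * conf => val p.1 - val p.2) @^-1` [set 0] `|`
    ((fun p : conf * conf => val p.1) @^-1` core_value `&`
     (fun p : conf * conf => val p.2) @^-1` core_value)).
  apply/seteqP; split=> [p [p1 p2 [e|[c1 c2]]]|p [[p1 p2] [e|[c1 c2]]]].
  - by split=> //; left; rewrite /= e subrr.
  - by split=> //; right.
  - by split=> //; left; apply/eqP; rewrite -subr_eq0; apply/eqP.
  - by split=> //; right.
apply: closedI.
  apply: closedI; apply: preimage_closed => // p _; first exact: cvg_fst.
  exact: cvg_snd.
apply: closedU.
  apply: preimage_closed => [p _|]; last exact: closed_eq.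
  apply: (@continuousB R R^o _ (fun p : conf * conf => val p.1)
    (fun p : conf * conf => val p.2)); first exact: cont1.
  exact: cont2.
apply: closedI; apply: preimage_closed; try exact: core_value_closed.
  by move=> p _; exact: cont1.
by move=> p _; exact: cont2.
Qed.

Lemma kernel_rel_ok :
  closed_invariant_equivalence (beta_shift beta) kernel_rel.
Proof.
rewrite beta_shiftE //; split; last 2 first.
- exact: kernel_rel_closed.
- move=> x y [xd yd xy]; split; try exact: (@adm_iter _ _ 1).
  case: xy => [|[cx cy]]; first exact: shift_same_value.
  by right; split; exact: core_value_shift.
split.
- by move=> p [].
- by move=> x xd; split=> //; left.
- by move=> x y [xd yd xy]; split=> //; case: xy => [->|[]]; [left|right].
move=> x y z [xd yd xy] [_ zd yz]; split=> //.
by case: xy yz => [/= ->|[cx cy]] [/= <-|[cy' cz]]; [left|right|right|right].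
Qed.

Lemma beta_kernelE : beta_kernel beta = kernel_rel.
Proof.
apply/seteqP; split=> p.
  apply; split; first exact: kernel_rel_ok.
  by move=> q []; rewrite beta_shiftE // => q1 q2 e; split=> //; left.
move=> [p1 p2 pe] E [[[ES Er Es Et] Ec Ei] E0].
have E0' x y : admissible d x -> admissible d y -> val x = val y -> E (x, y).
  by move=> xd yd xy; apply: E0; rewrite beta_shiftE.
(* the pair (0d, 10^oo) shifts to (d, 0^oo) *)
have Ed : E (d, zeros).
  pose x : conf := splice 1 zeros d.
  have sx : sg x = d by apply: (iter_shift_splice 1).
  have sp : sg (pulse 0) = zeros :> conf.
    apply/funext => i; apply: (@dig_inj _ _ zeros).
    by rewrite /dig /sigma /pulse inordK.
  have xp : E (x, pulse 0).
    apply: E0'.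
    - by apply: adm_cons; rewrite ?sx // dig0_gt0.
    - exact: adm_pulse.
    apply: (@real_of_twin _ _ beta1 _ _ 0) => //.
    by rewrite (dig_pulse d_adm).
  by have := Ei _ _ xp; rewrite sx sp.
have Eorb n : E (iter n sg d, zeros).
  elim: n => // n IHn; have := Ei _ _ IHn.
  by rewrite -[sg zeros]/(iter 1 sg zeros) iter_zeros.
have Ecl x : core x -> E (x, zeros).
  move=> [xc|->]; last by apply: Er; rewrite beta_shiftE //; exact: adm_zeros.
  have cl : closed ((fun x : conf => (x, zeros : conf)) @^-1` E).
    apply: preimage_closed => [z _ U [ [P Q] [/= Pz Qz] PQ]|//].
    apply: (filterS _ Pz) => y Py; apply: PQ; split=> //.
    exact: nbhs_singleton Qz.
  apply: cl; apply: closure_subset xc => _ [n _ <-]; exact: Eorb.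
have Ecv x : admissible d x -> core_value (val x) -> E (x, zeros).
  move=> xd [c cc cx]; apply: (Et _ c); last exact: Ecl.
  by apply: E0' => //; exact: core_adm.
case: p p1 p2 pe => x y /= xd yd [|[cx cy]]; first exact: E0'.
by apply: (Et _ zeros); [exact: Ecv|apply: Es; exact: Ecv].
Qed.

Lemma zip_iter n x y :
  iter n (@sigma (A * A)%type) (zip_conf (x, y)) =
  zip_conf (iter n sg x, iter n sg y).
Proof. by elim: n => // n IHn; rewrite !iterS IHn. Qed.

Lemma zip_splice n x y x' y' :
  splice n (zip_conf (x, y)) (zip_conf (x', y')) =
  zip_conf (splice n x x', splice n y y').
Proof. by apply/funext => i; rewrite /splice /zip_conf /=; case: ifP. Qed.

Lemma beta_kernel_zipP (Z : set (configuration (A * A)%type)) :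
  beta_kernel beta =
    (@zip_conf A @^-1` Z) `&` (beta_shift beta `*` beta_shift beta) <->
  forall x y, admissible d x -> admissible d y ->
    (kernel_rel (x, y) <-> Z (zip_conf (x, y))).
Proof.
rewrite beta_kernelE beta_shiftE //; split=> [KZ x y xd yd|KZ].
  by rewrite KZ; split=> [[]|].
apply/seteqP; split=> -[x y].
  by move=> /[dup] K [xd yd _]; split; [exact/KZ|split].
by move=> [/= h [/= xd yd]]; exact/KZ.
Qed.

Lemma rel_SFTP : rel_SFT (beta_shift beta) (beta_kernel beta) <->
  exists2 Z, is_SFT Z & forall x y, admissible d x -> admissible d y ->
    (kernel_rel (x, y) <-> Z (zip_conf (x, y))).
Proof.
by split=> [[Z [hZ /beta_kernel_zipP h]]|[Z hZ /beta_kernel_zipP h]]; exists Z.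
Qed.

Lemma rel_soficP : rel_sofic (beta_shift beta) (beta_kernel beta) <->
  exists2 Z, is_sofic Z & forall x y, admissible d x -> admissible d y ->
    (kernel_rel (x, y) <-> Z (zip_conf (x, y))).
Proof.
by split=> [[Z [hZ /beta_kernel_zipP h]]|[Z hZ /beta_kernel_zipP h]]; exists Z.
Qed.

Lemma dense_rel_SFT : dense_in (orbit_of d) (beta_shift beta) ->
  rel_SFT (beta_shift beta) (beta_kernel beta).
Proof.
move=> [_ dense]; rewrite beta_shiftE // in dense; apply/rel_SFTP.
exists setT; first by exists [::]; apply/seteqP; split.
move=> x y xd yd; split=> // _; split=> //; right.
by split; [exists x|exists y] => //; left; exact: dense.
Qed.

End Kernel.

(** * Kernels which are not of finite type *)

Section KernelNotSFT.
Context {R : realType} {beta : R} (beta1 : 1 < beta).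
Local Notation A := ('I_(Num.truncn beta).+1).
Local Notation conf := (configuration A).
Local Notation sg := (@sigma A).
Local Notation d := (quasi_expansion_one beta).
Local Notation val := (real_of beta).
Local Notation core_val := (@core_value R beta).
Implicit Types (x y z : conf).

Let d_adm : admissible d d := quasi_adm beta1.
Let d_pos : ~ ends_zero d := quasi_not_ends_zero beta1.

Lemma finite_orbit : eventually_periodic d -> finite_set (orbit_of d).
Proof.
move=> /eventually_periodic_orbit[m [r hr]].
apply: (@sub_finite_set _ _ ((fun i : 'I_m.+1 => iter i sg d) @` setT)).
  by move=> _ [j _ <-]; exists (r j).
exact/finite_image/finite_finset.
Qed.

Lemma closure_finite_orbit : eventually_periodic d ->
  closure (orbit_of d) = orbit_of d.
Proof.
move=> /finite_orbit/finite_closed_configurations.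
by move=> /closure_id.
Qed.

Lemma finite_core_value : eventually_periodic d -> finite_set (core_val).
Proof.
move=> ev; apply: finite_image; rewrite /core closure_finite_orbit //.
by rewrite finite_setU; split; [exact: finite_orbit|exact: finite_set1].
Qed.

(** At most two admissible sequences share a value, hence the points with a
    value in [core_value] are finitely many. *)
Lemma finite_core_class : eventually_periodic d ->
  finite_set [set x : conf | admissible d x /\ core_val (val x)].
Proof.
move=> ev; have fin (P : set conf) :
    (forall x y, P x -> P y -> (ends_zero x <-> ends_zero y)) ->
    finite_set [set x | [/\ admissible d x, core_val (val x) & P x]].
  move=> hP.
  pose g r := xget zeros [set x | [/\ admissible d x, P x & val x = r]].
  apply: (@sub_finite_set _ _ (g @` core_val)); last first.
    exact/finite_image/finite_core_value.
  move=> x [xd cx Px]; exists (val x) => //; rewrite /g.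
  case: xgetP => [y _ [yd Py yx]|/(_ x)[]//].
  by apply: (real_of_inj beta1) => //; exact: hP.
apply: (@sub_finite_set _ _
    ([set x | [/\ admissible d x, core_val (val x) & ends_zero x]] `|`
     [set x | [/\ admissible d x, core_val (val x) & ~ ends_zero x]])).
  by move=> x [xd cx]; have [ex|nx] := pselect (ends_zero x); [left|right].
by rewrite finite_setU; split; apply: fin.
Qed.

(** Two points with distinct first letters, the same tail, and values in
    [core_value], force a relation which is not of finite type: far to the
    right, the common tail can be changed in a way which leaves the kernel. *)
Lemma not_rel_SFT x y : eventually_periodic d ->
  admissible d x -> admissible d y ->
  core_val (val x) -> core_val (val y) ->
  sg x = sg y -> dig x 0 <> dig y 0 ->
  ~ rel_SFT (beta_shift beta) (beta_kernel beta).
Proof.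
move=> ev xd yd cx cy sxy xy0 /(rel_SFTP beta1)[Z hZ KZ].
have [M glue] := SFT_glue hZ.
have [Nx hx] := adm_splice_pulse d_adm d_pos M.+1 xd.
have [Ny hy] := adm_splice_pulse d_adm d_pos M.+1 yd.
pose X m := splice M.+1 x (pulse m); pose Y m := splice M.+1 y (pulse m).
pose N := maxn Nx Ny.
have Xd m : admissible d (X (N + m)%N) by apply: hx; lia.
have Yd m : admissible d (Y (N + m)%N) by apply: hy; lia.
(* the values of the [X (N + m)] are pairwise distinct, so one of them is not in
   the finite set [core_val] *)
have Xinj m m' : val (X (N + m)%N) = val (X (N + m')%N) -> m = m'.
  move=> /(real_of_inj beta1 (Xd m) (Xd m')) XX.
  have {}XX : X (N + m)%N = X (N + m')%N.
    by apply: XX; split=> _; apply/ends_zero_splice/ends_zero_pulse.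
  have := congr1 (iter M.+1 sg) XX; rewrite !iter_shift_splice.
  move=> /(congr1 (fun z => dig z (N + m))); rewrite (dig_pulse d_adm d_pos).
  rewrite /dig /pulse eqn_add2l; case: eqP => // _.
  by rewrite inordK.
have [m nm] : exists m, ~ core_val (val (X (N + m)%N)).
  apply: contrapT => /forallNP h; apply: infinite_nat.
  pose g r := xget 0%N [set m | val (X (N + m)%N) = r].
  apply: (@sub_finite_set _ _ (g @` core_val)); last first.
    exact/finite_image/finite_core_value.
  move=> m _; exists (val (X (N + m)%N)); first exact: contrapT (h m).
  rewrite /g; case: xgetP => [m1 _ /= /Xinj|/(_ m) k] //.
  by case: k.
have sXY : sg (X (N + m)%N) = sg (Y (N + m)%N).
  apply/funext => i; have := congr1 (fun z : conf => z i) sxy.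
  by rewrite /sigma /X /Y /splice => ->.
have Xx : agree M.+1 (X (N + m)%N) x by exact: agree_splice.
have Yy : agree M.+1 (Y (N + m)%N) y by exact: agree_splice.
have : kernel_rel (X (N + m)%N, Y (N + m)%N).
  apply/KZ => //.
  have Zxy : Z (zip_conf (x, y)) by apply/KZ => //; split=> //; right.
  have Zt : Z (zip_conf (sg (X (N + m)%N), sg (Y (N + m)%N))).
    have sd : admissible d (sg (X (N + m)%N)) by exact: (@adm_iter _ _ 1).
    by apply/KZ; rewrite -?sXY //; split=> //; left.
  have -> : zip_conf (X (N + m)%N, Y (N + m)%N) = splice 1 (zip_conf (x, y))
      (zip_conf (sg (X (N + m)%N), sg (Y (N + m)%N))).
    apply/funext => -[|i]; rewrite /splice /zip_conf /=.
      by rewrite Xx // Yy.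
    by rewrite subSS subn0.
  apply: glue => // i iM.
  rewrite -[iter 1 _ _ i]/(x i.+1, y i.+1) /zip_conf /=.
  by rewrite /sigma Xx ?ltnS // Yy.
move=> [_ _ /= [eXY|[]//]].
apply: xy0; have := real_ofE beta1 (X (N + m)%N).
rewrite eXY real_ofE // sXY => /addIr/eqP.
rewrite eqr_nat => /eqP.
by rewrite [dig (X _) 0]/dig Xx // [dig (Y _) 0]/dig Yy.
Qed.

(** Strictly eventually periodic case: two distinct letters precede the first
    point of the cycle. *)
Lemma strictly_eventually_not_rel_SFT : strictly_eventually_periodic d ->
  ~ rel_SFT (beta_shift beta) (beta_kernel beta).
Proof.
move=> [ev ntp]; have /eventually_periodicP[n0 [m0 [nm0 dnm0]]] := ev.
have ex : exists n, `[< exists m, (n < m)%N /\ iter n sg d = iter m sg d >].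
  by exists n0; apply/asboolP; exists m0.
case: (ex_minnP ex) => -[|n] /asboolP[m [nm dnm]] nmin.
  case: ntp; apply/totally_periodicP; exists m => //.
case: m => [//|m] in nm dnm.
apply: (@not_rel_SFT (iter n sg d) (iter m sg d)) => //; try exact: adm_iter.
- by exists (iter n sg d) => //; exact: core_orbit.
- by exists (iter m sg d) => //; exact: core_orbit.
move=> e; have : (n.+1 <= n)%N; last by rewrite ltnn.
apply: nmin; apply/asboolP; exists m; split=> //.
rewrite -(splice_shift 1 (iter n sg d)) -(splice_shift 1 (iter m sg d)).
rewrite -!iterS dnm; apply/funext => -[|i] //; rewrite /splice /=.
exact: dig_inj.
Qed.

(** Totally periodic case: if [d] has period [p], then [(d_(p-1) + 1)0^oo] has
    the same value as [sigma^(p-1) d], and the same tail as [0^oo]. *)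
Lemma totally_periodic_not_rel_SFT : totally_periodic d ->
  beta \isn't a Num.nat -> ~ rel_SFT (beta_shift beta) (beta_kernel beta).
Proof.
move=> tp bN; have ev := totally_eventually_periodic tp.
have /totally_periodicP[[//|p] _ dp] := tp.
have lt : (dig d p < dig d 0)%N.
  have le : lex (iter p sg d) d by exact: d_adm.
  have : (dig d p <= dig d 0)%N.
    by have := le 0%N; rewrite dig_iter addn0; apply.
  rewrite leq_eqVlt => /orP[/eqP e|//]; case/negP: bN.
  apply/(nat_beta_quasi_const beta1).
  apply: lex_antisym; first exact: (@d_adm 1).
  have a : agree 1 (iter p sg d) d.
    by move=> [|//] _; apply: dig_inj; rewrite dig_iter addn0.
  by have /(lex_iter a) := le; rewrite -iterD add1n dp.
pose x : conf := fun i => if i is 0%N then inord (dig d p).+1 else ord0.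
have sx : sg x = zeros by apply/funext.
have x0 : dig x 0 = (dig d p).+1.
  by rewrite /dig /x inordK // (leq_ltn_trans lt) //; exact: ltn_ord.
have vx : val (iter p sg d) = val x.
  apply: (@real_of_twin _ _ beta1 _ _ 0) => //.
  by rewrite x0 dig_iter addn0.
apply: (@not_rel_SFT x zeros) => //.
- by apply: adm_cons_zeros => //; rewrite x0.
- exact: adm_zeros.
- by rewrite -vx; exists (iter p sg d) => //; exact: core_orbit.
- exact: core_value_zeros.
by rewrite x0.
Qed.

End KernelNotSFT.

(** * Sofic kernels and dense orbits *)

Section KernelSofic.
Context {R : realType} {beta : R} (beta1 : 1 < beta).
Local Notation A := ('I_(Num.truncn beta).+1).
Local Notation conf := (configuration A).
Local Notation sg := (@sigma A).
Local Notation d := (quasi_expansion_one beta).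
Local Notation val := (real_of beta).
Local Notation core_val := (@core_value R beta).
Implicit Types (x y z : conf).

Let d_adm : admissible d d := quasi_adm beta1.
Let d_pos : ~ ends_zero d := quasi_not_ends_zero beta1.

Lemma dense_not_eventually_periodic :
  dense_in (orbit_of d) (beta_shift beta) -> ~ eventually_periodic d.
Proof.
move=> [_ dense] ev; rewrite beta_shiftE // closure_finite_orbit // in dense.
have [n _ e] := dense (pulse 0) (adm_pulse d_adm d_pos (m := 0)).
by apply: d_pos; apply/(ends_zero_iter n); rewrite e; exact: ends_zero_pulse.
Qed.

(** In a relatively sofic kernel, two prefixes of the pair [(X, Y)], with
    [X = u0d] and [Y = u10^oo], have the same followers. Exchanging the tails
    of [X] behind them gives a point related to [Y] with another value, so
    that [Y] belongs to the exceptional class. As [u] is an arbitrary word of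
    the shift, the orbit of [d] is dense. *)
Lemma rel_sofic_dense : ~ eventually_periodic d ->
  rel_sofic (beta_shift beta) (beta_kernel beta) ->
  dense_in (orbit_of d) (beta_shift beta).
Proof.
move=> nev /(rel_soficP beta1)[Z hZ KZ]; rewrite beta_shiftE //.
split; first exact: orbit_adm.
move=> x xd; apply/closure_cylinder => n.
have [N /(_ N (leqnn N)) Yd] := adm_splice_pulse d_adm d_pos n xd.
set Y := splice n x (pulse N) in Yd; set c := (n + N)%N.
pose X : conf := splice c Y (splice 1 zeros d).
have cY : iter c sg Y = pulse 0.
  by rewrite /c addnC iterD iter_shift_splice -[N in pulse N]addn0 iter_pulse.
have cX : iter c sg X = splice 1 zeros d by exact: iter_shift_splice.
have cX1 : iter c.+1 sg X = d by rewrite iterS cX; exact: (iter_shift_splice 1).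
have cY1 : iter c.+1 sg Y = zeros.
  rewrite iterS cY; apply/funext => i; apply: (@dig_inj _ _ zeros).
  by rewrite /dig /sigma /pulse inordK.
have dXc : dig X c = 0%N by rewrite -[c]addn0 -dig_iter cX.
have dYc : dig Y c = 1%N.
  by rewrite -[c]addn0 -dig_iter cY (dig_pulse d_adm d_pos).
have XY : agree c X Y by exact: agree_splice.
have Xd : admissible d X.
  apply: (@adm_tail _ d c Y) => //; first exact: agree_sym.
    rewrite cX; apply: adm_cons; first exact: (dig0_gt0 d_adm d_pos).
    by rewrite (_ : sg _ = d) //; exact: (iter_shift_splice 1).
  rewrite cX cY; apply: (@lex_lt _ 0) => //.
  by rewrite (dig_pulse d_adm d_pos).
have vXY : val X = val Y.
  by apply: (@real_of_twin _ _ beta1 _ _ c); rewrite ?dXc ?dYc.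
have Xnz : ~ ends_zero X by rewrite -(ends_zero_iter c.+1) cX1.
have ZXY : Z (zip_conf (X, Y)) by apply/KZ => //; split=> //; left.
have tail a : (c < a)%N -> iter a sg X = iter (a - c.+1) sg d.
  by move=> ca; rewrite -{1}(subnK ca) iterD cX1.
have tailY a : (c < a)%N -> iter a sg Y = zeros.
  by move=> ca; rewrite -(subnK ca) iterD cY1 iter_zeros.
have key a b : (c < a)%N -> (c < b)%N -> a <> b ->
    (forall t, Z (splice a (zip_conf (X, Y)) t) ->
               Z (splice b (zip_conf (X, Y)) t)) ->
    lex (iter a sg X) (iter b sg X) -> core_val (val Y).
  move=> ca cb ab hab le.
  have Wd : admissible d (splice b X (iter a sg X)).
    by apply: adm_splice => //; exact: adm_iter.
  have : kernel_rel (splice b X (iter a sg X), Y).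
    apply/KZ => //.
    have : Z (splice b (zip_conf (X, Y))
        (iter a (@sigma (A * A)%type) (zip_conf (X, Y)))).
      by apply: hab; rewrite splice_shift.
    by rewrite zip_iter zip_splice tailY // -(tailY b) // splice_shift.
  move=> [_ _ /= [|[]//]]; rewrite -vXY => e; exfalso.
  have {}e : splice b X (iter a sg X) = X.
    apply: (real_of_inj beta1) => //.
    by rewrite ends_zero_splice ends_zero_iter.
  apply: nev; apply/eventually_periodicP.
  have ee : iter (a - c.+1) sg d = iter (b - c.+1) sg d.
    by rewrite -!tail // -[in RHS]e iter_shift_splice.
  case: (ltngtP a b) => // lt.
    by exists (a - c.+1)%N, (b - c.+1)%N; split=> //; lia.
  by exists (b - c.+1)%N, (a - c.+1)%N; split=> //; lia.
have [z cz vz] : core_val (val Y).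
  have [a [b [ca ab hab]]] := sofic_pigeonhole (zip_conf (X, Y)) c.+1 hZ.
  have cb : (c < b)%N by exact: ltn_trans ab.
  case: (lex_total (iter a sg X) (iter b sg X)) => le.
    by apply: (key a b) => // [|t /hab//]; lia.
  by apply: (key b a) => // [|t /hab//]; lia.
have zd : admissible d z by exact: (core_adm beta1).
(* the only points of this value are X and Y, which both begin with the given
   word of length n *)
have zXY : z = X \/ z = Y.
  have [ez|nz] := pselect (ends_zero z); [right|left]; last first.
    by apply: (real_of_inj beta1); rewrite ?vXY.
  apply: (real_of_inj beta1) => //; split=> // _.
  by apply/ends_zero_splice/ends_zero_pulse.
have zx : agree n z x.
  have Yx : agree n Y x by exact: agree_splice.
  case: zXY => -> //; apply: agree_trans Yx.
  by apply: agree_le XY; rewrite leq_addr.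
case: cz => [/closure_cylinder/(_ n)[w wO zw]|/= z0].
  by exists w => //; apply: agree_trans zw; exact: agree_sym.
case: zXY => zE; rewrite z0 in zE.
  by case: Xnz; rewrite -zE; exists 0%N.
by move: dYc; rewrite -zE.
Qed.

End KernelSofic.

(** * Integer bases *)

(** Condition on the first three pairs of letters of two sequences [f] and [g].
    When it holds at all positions and [0 < b], distinct sequences coincide up
    to a pair [(a, a+1)] followed by [(b, 0)] forever, or are [b^oo] and
    [0^oo]; or the same with [f] and [g] exchanged.  It is used for
    [d = b^oo]. *)
Definition carry_window (b : nat) (f g : nat -> nat) : Prop :=
  let top i := f i = b /\ g i = 0%N in
  let bot i := f i = 0%N /\ g i = b in
  [\/ f 0%N = g 0%N /\ [\/ f 1%N = g 1%N, g 1%N = (f 1%N).+1 /\ top 2%N |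
                        f 1%N = (g 1%N).+1 /\ bot 2%N],
      (g 0%N = (f 0%N).+1 \/ top 0%N) /\ (top 1%N /\ top 2%N) |
      (f 0%N = (g 0%N).+1 \/ bot 0%N) /\ (bot 1%N /\ bot 2%N)].

Lemma carry_window_sym b f g : carry_window b f g -> carry_window b g f.
Proof.
case=> [[e [e1|[e1 [t1 t2]]|[e1 [t1 t2]]]]|[h [[a1 a2] [b1 b2]]]|
        [h [[a1 a2] [b1 b2]]]].
- by apply: Or31; split=> //; apply: Or31.
- by apply: Or31; split=> //; apply: Or33.
- by apply: Or31; split=> //; apply: Or32.
- by apply: Or33; split=> //; case: h => [->|[? ?]]; [left|right].
by apply: Or32; split=> //; case: h => [->|[? ?]]; [left|right].
Qed.

Section KernelPeriodic.
Context {R : realType} {beta : R} (beta1 : 1 < beta).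
Local Notation A := ('I_(Num.truncn beta).+1).
Local Notation conf := (configuration A).
Local Notation sg := (@sigma A).
Local Notation d := (quasi_expansion_one beta).
Local Notation val := (real_of beta).
Local Notation core_val := (@core_value R beta).
Implicit Types (x y z : conf).

Let d_adm : admissible d d := quasi_adm beta1.
Let d_pos : ~ ends_zero d := quasi_not_ends_zero beta1.

Lemma kernel_rel_sym x y : kernel_rel (x, y) -> kernel_rel (y, x).
Proof. by move=> [xd yd /= [e|[cx cy]]]; split=> //; [left|right]. Qed.

Section Constant.
Hypothesis dconst : sg d = d.
Let b := dig d 0.

Let iter_d n : iter n sg d = d.
Proof. by elim: n => // n IHn; rewrite iterS IHn. Qed.

Let dig_d i : dig d i = b.
Proof. by rewrite -[i]addn0 -dig_iter iter_d. Qed.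

Let b_gt0 : (0 < b)%N := dig0_gt0 d_adm d_pos.

Lemma const_core_value x : admissible d x -> core_val (val x) ->
  x = d \/ x = zeros.
Proof.
move=> xd [c [/closure_cylinder h|->] cx]; [left|right].
  have cd : c = d.
    by apply: agree_eq => n; have [_ [i _ <-]] := h n; rewrite iter_d.
  by apply: (real_of_adm_eq1 beta1) => //; rewrite -cx cd real_of_quasi1.
by apply: (real_of_eq0 beta1); rewrite -cx real_of_zeros.
Qed.

Lemma coincidence_window x y n : admissible d x -> admissible d y ->
  val x = val y -> agree n x y -> (dig x n < dig y n)%N ->
  forall i, carry_window b (dig (iter i sg x)) (dig (iter i sg y)).
Proof.
move=> xd yd xy a lt i.
have [yn xS yS] := real_of_coincidence beta1 xd yd xy a lt.
have top j : (n < j)%N -> dig x j = b /\ dig y j = 0%N.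
  move=> nj; rewrite -(subnKC nj) -!dig_iter xS yS dig_d.
  by split.
have eqd j : (j < n)%N -> dig x j = dig y j by move=> jn; rewrite /dig a.
rewrite /carry_window !dig_iter.
case: (ltngtP i n) => [iltn|nlti|->].
- apply: Or31; rewrite !addn0 (eqd i) //; split=> //.
  have [i1|i1] := eqVneq (i + 1)%N n; last by apply: Or31; rewrite eqd //; lia.
  by apply: Or32; rewrite i1 yn; split=> //; apply: top; lia.
- apply: Or32; split; first by right; apply: top; rewrite addn0.
  by split; apply: top; lia.
apply: Or32; split; first by left; rewrite !addn0.
by split; apply: top; lia.
Qed.

Lemma kernel_window x y : kernel_rel (x, y) ->
  forall i, carry_window b (dig (iter i sg x)) (dig (iter i sg y)).
Proof.
move=> [/= xd yd xy] i.
have [->|/first_difference[n [a ne]]] := pselect (x = y).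
  by apply: Or31; split=> //; apply: Or31.
case: xy => [xy|[/(const_core_value xd) cx /(const_core_value yd) cy]].
  case: (ltngtP (dig x n) (dig y n)) => [lt|lt|/dig_inj //].
    exact: coincidence_window xy a lt i.
  apply: carry_window_sym.
  exact: coincidence_window (esym xy) (agree_sym a) lt i.
case: cx => xE; case: cy => yE; rewrite xE yE in ne *.
- by case: ne.
- apply: Or32; rewrite !iter_d !iter_zeros /carry_window !dig_d.
  by split; [right|].
- apply: Or33; rewrite !iter_d !iter_zeros /carry_window !dig_d.
  by split; [right|].
- by case: ne.
Qed.

(** Once two distinct sequences read a carry, or start with [(b, 0)], and then
    read [(b, 0)], they read [(b, 0)] forever, hence are related. *)
Lemma window_kernel_aux x y n : admissible d x -> admissible d y ->
  (forall i, carry_window b (dig (iter i sg x)) (dig (iter i sg y))) ->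
  agree n x y ->
  dig y n = (dig x n).+1 \/ (n = 0%N /\ (dig x n = b /\ dig y n = 0%N)) ->
  dig x n.+1 = b -> dig y n.+1 = 0%N -> kernel_rel (x, y).
Proof.
move=> xd yd W a hn xS yS.
have ne j : dig x j = b -> dig y j = 0%N -> dig x j <> dig y j.
  by move=> -> -> e; move: b_gt0; rewrite e.
have nen : dig x n <> dig y n by case: hn => [->|[_ [? ?]]]; [lia|exact: ne].
have top j : (dig x (n.+1 + j) = b /\ dig y (n.+1 + j) = 0%N) /\
    dig x (n + j) <> dig y (n + j).
  elim: j => [|j [ [hx hy] nej] ]; first by rewrite !addn0.
  split; last by rewrite -addSnnS; exact: ne.
  have := W (n + j)%N; rewrite /carry_window !dig_iter !addn0.
  have -> : (n + j + 1 = n.+1 + j)%N by lia.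
  have -> : (n + j + 2 = n.+1 + j.+1)%N by lia.
  case=> [[//]|[_ [_ //]]|[_ [[h _] _]]].
  by move: b_gt0; rewrite -hx h.
have xd' : iter n.+1 sg x = d.
  apply/funext => j; apply: dig_inj; rewrite dig_iter dig_d.
  by case: (top j) => -[].
have y0 : iter n.+1 sg y = zeros.
  apply/funext => j; apply: (@dig_inj _ _ zeros); rewrite dig_iter.
  by case: (top j) => -[].
split=> //=; case: hn => [yn|[n0 [x0 y0']]].
  by left; exact: (@real_of_twin _ _ beta1 _ _ n).
right; rewrite n0 in xd' y0 x0 y0'.
have -> : x = d.
  rewrite -(splice_shift 1 x) -(splice_shift 1 d) xd'.
  rewrite -[iter 1 sg d]/(sg d) dconst.
  apply/funext => -[|i] //; apply: dig_inj.
  by rewrite /dig /splice /= -/(dig x 0) x0.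
have -> : y = zeros.
  rewrite -(splice_shift 1 y) -(splice_shift 1 zeros) y0 iter_zeros.
  apply/funext => -[|i] //; apply: (@dig_inj _ _ (splice 1 zeros zeros)).
  by rewrite /dig /splice /= -/(dig y 0) y0'.
by split; [exact: core_value_quasi|exact: core_value_zeros].
Qed.

Lemma window_kernel x y : admissible d x -> admissible d y ->
  (forall i, carry_window b (dig (iter i sg x)) (dig (iter i sg y))) ->
  kernel_rel (x, y).
Proof.
move=> xd yd W.
have [->|/first_difference[n [a ne]]] := pselect (x = y).
  by split=> //; left.
have {}ne : dig x n <> dig y n by move=> /dig_inj.
have W' i : carry_window b (dig (iter i sg y)) (dig (iter i sg x)).
  exact: carry_window_sym.
case: n => [|n] in a ne.
  have := W 0%N; rewrite /carry_window /=.
  case=> [[//]|[h [[? ?] _]]|[h [[? ?] _]]].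
    apply: (window_kernel_aux xd yd W a) => //.
    by case: h => [->|[? ?]]; [left|right].
  apply: kernel_rel_sym.
  apply: (window_kernel_aux yd xd W' (agree_sym a)) => //.
  by case: h => [->|[? ?]]; [left|right].
have eqn : dig x n = dig y n by rewrite /dig a.
have := W n; rewrite /carry_window !dig_iter addn0 addn1 addn2 eqn.
case=> [[_ [//|[e [? ?]]|[e [? ?]]]]|[[k|[h h0]] _]|[[k|[h h0]] _]].
- by apply: (window_kernel_aux xd yd W a) => //; left.
- apply: kernel_rel_sym.
  apply: (window_kernel_aux yd xd W' (agree_sym a)) => //.
  by left.
- by case: (n_Sn _ k).
- by move: b_gt0; rewrite -h h0.
- by case: (n_Sn _ k).
- by move: b_gt0; rewrite -h0 h.
Qed.

End Constant.

Lemma nat_rel_SFT : beta \is a Num.nat ->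
  rel_SFT (beta_shift beta) (beta_kernel beta).
Proof.
move=> /(nat_beta_quasi_const beta1) dc; apply/(rel_SFTP beta1).
pose Q (z : configuration (A * A)%type) := carry_window (dig d 0)
  (fun j => nat_of_ord (z j : A * A).1) (fun j => nat_of_ord (z j : A * A).2).
exists [set z | forall i, Q (iter i (@sigma (A * A)%type) z)].
  apply: (@SFT_local _ 3 Q) => u v uv.
  by rewrite /Q /carry_window !uv.
move=> x y xd yd; split=> [K i|h].
  by rewrite zip_iter; exact: kernel_window.
apply: window_kernel => // i.
by have := h i; rewrite zip_iter.
Qed.

(** * The kernel for an eventually periodic expansion *)

(** A state is a pair of letters as long as the two sequences agree and at the
    carry, then the pair of the remaining sequences, taken in the finite
    exceptional class. *)
Lemma eventually_periodic_rel_sofic : eventually_periodic d ->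
  rel_sofic (beta_shift beta) (beta_kernel beta).
Proof.
move=> ev; apply/(rel_soficP beta1).
set C := [set x : conf | admissible d x /\ core_val (val x)].
have Cfin : finite_set (C `*` C).
  by apply: finite_setX; exact: finite_core_class.
have Cshift x : C x -> C (sg x).
  by move=> [xd cx]; split; [exact: (@adm_iter _ _ 1)|exact: core_value_shift].
have Citer n x : C x -> C (iter n sg x).
  by move=> Cx; elim: n => // n IHn; exact: Cshift.
have Cd : C d by split; [exact: d_adm|exact: core_value_quasi].
have C0 : C zeros by split; [exact: adm_zeros|exact: core_value_zeros].
have /finite_seqP[s sE] := Cfin.
pose pt (t : 'I_(size s)) : conf * conf := nth (d, zeros) s t.
have ptC t : C (pt t).1 /\ C (pt t).2.
  have : (C `*` C) (pt t) by rewrite sE /= mem_nth.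
  by [].
have [idx idxE] : exists idx : conf * conf -> 'I_(size s),
    forall x y, C x -> C y -> pt (idx (x, y)) = (x, y).
  have h (p : conf * conf) : exists t : 'I_(size s), (C `*` C) p -> pt t = p.
    have [pC|pC] := pselect ((C `*` C) p); last first.
      have : (d, zeros) \in s by have : (C `*` C) (d, zeros) by []; rewrite sE.
      by rewrite -index_mem => lt; exists (Ordinal lt).
    have ps : p \in s by move: pC; rewrite sE.
    have lt : (index p s < size s)%N by rewrite index_mem.
    by exists (Ordinal lt) => _; rewrite /pt nth_index.
  have [idx hidx] := choice h.
  by exists idx => x y Cx Cy; exact: hidx.
pose V := ((A * A) + 'I_(size s))%type.
pose e (u v : V) := match u, v with
  | inl p, inl q => p.1 = p.2
  | inl p, inr t =>
      (nat_of_ord p.2 = (nat_of_ord p.1).+1 /\ pt t = (d, zeros)) \/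
      (nat_of_ord p.1 = (nat_of_ord p.2).+1 /\ pt t = (zeros, d))
  | inr t, inr t' => pt t' = (sg (pt t).1, sg (pt t).2)
  | inr _, inl _ => False
  end.
pose l (v : V) : A * A := match v with
  | inl p => p
  | inr t => ((pt t).1 0%N, (pt t).2 0%N)
  end.
eexists; first exact: (graph_sofic e l).
move=> x y xd yd; split=> [[_ _ /= xy]|[v [ev' lv]]].
  have [<-|/first_difference[n [a ne]]] := pselect (x = y).
    by exists (fun i => inl (x i, x i)).
  case: xy => [xy|[cx cy]]; last first.
    exists (fun i => inr (idx (iter i sg x, iter i sg y))); split=> i.
      by rewrite /e !idxE //; apply: Citer.
    rewrite /l idxE; try exact: Citer.
    by rewrite /= /zip_conf /= !iter_shiftE addn0.
  exists (fun i => if (i <= n)%N then inl (x i, y i)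
                   else inr (idx (iter i sg x, iter i sg y))).
  have co : [/\ C (iter n.+1 sg x), C (iter n.+1 sg y) &
    (dig y n = (dig x n).+1 /\ (iter n.+1 sg x, iter n.+1 sg y) = (d, zeros)) \/
    (dig x n = (dig y n).+1 /\ (iter n.+1 sg x, iter n.+1 sg y) = (zeros, d))].
    case: (ltngtP (dig x n) (dig y n)) => [lt|lt|/dig_inj //].
      have [-> -> ->] := real_of_coincidence beta1 xd yd xy a lt.
      by split=> //; left.
    have [-> -> ->] :=
      real_of_coincidence beta1 yd xd (esym xy) (agree_sym a) lt.
    by split=> //; right.
  have [Cx Cy hn] := co.
  have Cxi i : (n < i)%N -> C (iter i sg x).
    by move=> ni; rewrite -(subnK ni) iterD; exact: Citer.
  have Cyi i : (n < i)%N -> C (iter i sg y).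
    by move=> ni; rewrite -(subnK ni) iterD; exact: Citer.
  split=> i.
    case: (ltngtP i n) => [iltn|nlti|->].
    - exact: a.
    - by rewrite /= !idxE; auto.
    by rewrite /= idxE.
  case: (leqP i n) => [//|ni]; rewrite /l idxE; auto.
  by rewrite /= /zip_conf /= !iter_shiftE addn0.
have stay i t j : v i = inr t -> exists t', v (i + j)%N = inr t' /\
    pt t' = (iter j sg (pt t).1, iter j sg (pt t).2).
  move=> vi; elim: j => [|j [t' [vj ptj]]].
    by exists t; rewrite addn0 /=; case: (pt t).
  have := ev' (i + j)%N; rewrite vj -addnS.
  case: (v (i + j.+1)%N) => //= t'' e''; exists t''; split=> //.
  by rewrite e'' ptj.
have read i t : v i = inr t -> (iter i sg x, iter i sg y) = pt t.
  move=> vi; rewrite [RHS]surjective_pairing; congr (_, _); apply/funext => j;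
    have [t' [vj ptj]] := stay i t j vi; have := lv (i + j)%N;
    rewrite vj /= ptj /zip_conf /= !iter_shiftE addn0 => -[] //.
have [[i0 hi0]|none] := pselect (exists i, exists t, v i = inr t); last first.
  suff -> : x = y by split=> //; left.
  apply/funext => i; have := lv i; have := ev' i.
  case vi: (v i) => [p|t]; last by case: none; exists i, t.
  case vi1: (v i.+1) => [q|t]; last by case: none; exists i.+1, t.
  by rewrite /= => pe; case: p pe {vi} => p1 p2 /= -> [-> ->].
have ex : exists i, `[< exists t, v i = inr t >] by exists i0; apply/asboolP.
case: (ex_minnP ex) => -[|n] /asboolP[t vt] nmin.
  have /= pe := read _ _ vt; have [[_ c1] [_ c2]] := ptC t.
  by split=> //; right; move: c1 c2; rewrite -pe.
have inl_le i : (i <= n)%N -> v i = inl (x i, y i).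
  move=> ni; case vi: (v i) => [p|t']; last first.
    have : (n.+1 <= i)%N by apply: nmin; apply/asboolP; exists t'.
    by rewrite ltnNge ni.
  by congr inl; have := lv i; rewrite vi.
have a : agree n x y.
  by move=> i ni; have := ev' i; rewrite !inl_le // ltnW.
have := ev' n; rewrite inl_le // vt /e -(read _ _ vt).
move=> /= [[yn [xS yS]]|[xn [xS yS]]]; split=> //; left.
  exact: (@real_of_twin _ _ beta1 _ _ n).
apply: esym; apply: (@real_of_twin _ _ beta1 _ _ n) => //.
exact: agree_sym.
Qed.

End KernelPeriodic.

(** * The classification *)

Lemma rel_SFT_sofic (A : finType) (S : set (configuration A)) K :
  rel_SFT S K -> rel_sofic S K.
Proof. by move=> [Z [/SFT_sofic hZ e]]; exists Z. Qed.

Lemma beta_shift_SFTP (R : realType) (beta : R) : 1 < beta ->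
  is_SFT (beta_shift beta) <-> totally_periodic (quasi_expansion_one beta).
Proof.
move=> beta1; rewrite beta_shiftE //.
by split; [apply: SFT_adm|apply: adm_SFT]; exact: quasi_adm.
Qed.

Lemma beta_shift_soficP (R : realType) (beta : R) : 1 < beta ->
  is_sofic (beta_shift beta) <->
  eventually_periodic (quasi_expansion_one beta).
Proof.
move=> beta1; rewrite beta_shiftE //.
by split; [apply: sofic_adm|apply: adm_sofic]; exact: quasi_adm.
Qed.

Lemma beta_kernel_SFTP (R : realType) (beta : R) : 1 < beta ->
  rel_SFT (beta_shift beta) (beta_kernel beta) <->
  beta \is a Num.nat \/
  dense_in (orbit_of (quasi_expansion_one beta)) (beta_shift beta).
Proof.
move=> beta1; split=> [K|[bN|dense]]; last 2 first.
- exact: nat_rel_SFT.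
- exact: dense_rel_SFT.
have [ev|nev] := pselect (eventually_periodic (quasi_expansion_one beta)).
  left; apply: contrapT => /negP bN.
  have [tp|ntp] := pselect (totally_periodic (quasi_expansion_one beta)).
    exact: totally_periodic_not_rel_SFT bN K.
  by apply: (@strictly_eventually_not_rel_SFT _ beta).
by right; apply: rel_sofic_dense => //; exact: rel_SFT_sofic.
Qed.

Lemma beta_kernel_soficP (R : realType) (beta : R) : 1 < beta ->
  rel_sofic (beta_shift beta) (beta_kernel beta) <->
  eventually_periodic (quasi_expansion_one beta) \/
  dense_in (orbit_of (quasi_expansion_one beta)) (beta_shift beta).
Proof.
move=> beta1; split=> [K|[ev|dense]].
- have [ev|nev] := pselect (eventually_periodic (quasi_expansion_one beta)).
    by left.
  by right; exact: rel_sofic_dense.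
- exact: eventually_periodic_rel_sofic.
exact/rel_SFT_sofic/dense_rel_SFT.
Qed.

Theorem theorem1p10 (R : realType) (beta : R) (hbeta : 1 < beta) :
  let S := beta_shift beta in
  let K := beta_kernel beta in
  let d := quasi_expansion_one beta in
  (* (1) *)
  (is_SFT S /\ rel_SFT S K <-> beta \is a Num.nat) /\
  (* (2) *)
  (is_SFT S /\ rel_proper_sofic S K <->
     beta \isn't a Num.nat /\ totally_periodic d) /\
  (* (3) *)
  (is_proper_sofic S /\ rel_proper_sofic S K <->
     strictly_eventually_periodic d) /\
  (* (4) *)
  (is_non_sofic S /\ rel_SFT S K <-> dense_in (orbit_of d) S) /\
  (* (5) *)
  (is_non_sofic S /\ rel_non_sofic S K <->
     [/\ ~ (beta \is a Num.nat),
         ~ (beta \isn't a Num.nat /\ totally_periodic d),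
         ~ strictly_eventually_periodic d
       & ~ dense_in (orbit_of d) S]) /\
  (* consequences *)
  [/\ ~ (is_SFT S /\ rel_non_sofic S K),
      ~ (is_non_sofic S /\ rel_proper_sofic S K)
    & ~ (is_proper_sofic S /\ rel_SFT S K)].
Proof.
move=> S K d.
have hSFT : is_SFT S <-> totally_periodic d := beta_shift_SFTP hbeta.
have hsof : is_sofic S <-> eventually_periodic d := beta_shift_soficP hbeta.
have kSFT := beta_kernel_SFTP hbeta; have ksof := beta_kernel_soficP hbeta.
rewrite -/S -/K -/d in kSFT ksof.
have natp : beta \is a Num.nat -> totally_periodic d.
  move=> /(nat_beta_quasi_const hbeta) dc.
  by apply/totally_periodicP; exists 1%N.
have tpev := @totally_eventually_periodic _ d.
have dnev : dense_in (orbit_of d) S -> ~ eventually_periodic d.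
  exact: dense_not_eventually_periodic.
have nn : beta \isn't a Num.nat <-> ~ beta \is a Num.nat.
  by split=> [/negP|/negP].
rewrite /rel_proper_sofic /is_proper_sofic /is_non_sofic /rel_non_sofic.
rewrite /strictly_eventually_periodic.
rewrite (propext hSFT) (propext hsof) (propext kSFT) (propext ksof).
rewrite (propext nn).
move: natp tpev dnev; clear.
move: (is_true _) (totally_periodic d) (eventually_periodic d) (dense_in _ _).
move=> N T E D NT TE DE.
have [n|n] := pselect N; have [t|t] := pselect T;
  have [e|e] := pselect E; have [dd|dd] := pselect D;
  do 4 (split; first tauto); (split; last by split; tauto);
  by split=> [?|[]]; [split|]; tauto.
Qed.
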